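(* Suppose $\Sigma$ is of type-H, and let $g$ be an exchangeable probability distribution on $\mathcal T$. Let $\lambda,\lambda_1,\lambda_2\in\mathbb R$ (with $1+2\lambda\ne0$ and $1+\lambda_1+\lambda_2\ne0$ whenever the total effect $\theta$ is concerned). Then a pseudo symmetric measure is $\mathcal E_g$-optimal for $\tau$ (respectively $\theta$) in the undirectional model with parameter $\lambda$ if and only if it is $\mathcal E_g$-optimal for $\tau$ (respectively $\theta$) in the directional model with parameters $\lambda_1,\lambda_2$. Furthermore, if $\lambda_1=\lambda_2=\lambda$, the same equivalence holds for $\mathcal A_g$-, $\mathcal D_g$- and $\mathcal T_g$-optimality.
   Context: Fix integers $k\ge 2$ and $t\ge 2$. Let $\mathcal S$ be the set of all $t^k$ sequences $s=(t_1,\dots,t_k)$ with entries $t_j\in\{1,\dots,t\}$. For $s\in\mathcal S$ let $T_s$ be the $k\times t$ matrix with $(j,i)$ entry equal to $1$ if $t_j=i$ and $0$ otherwise; let $H$ be the $k\times k$ matrix with $(i,j)$ entry $1$ if $i\equiv j+1\pmod k$ and $0$ otherwise; put $L_s=HT_s$, $R_s=H'T_s$ (a prime denotes transpose). Let $\Sigma$ be a fixed $k\times k$ positive definite matrix, $1_k$ the all-ones vector, and $\tilde B=\Sigma^{-1}-\Sigma^{-1}1_k1_k'\Sigma^{-1}/(1_k'\Sigma^{-1}1_k)$. With $G_0=T_s,G_1=L_s,G_2=R_s$ define for $0\le i,j\le 2$ the $t\times t$ matrices $C_{sij}=G_i'\tilde BG_j$. A measure is a vector $\xi=(p_s)_{s\in\mathcal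 S}$ with $p_s\ge0$, $\sum_sp_s=1$; $\mathcal P$ is the set of all measures. Put $C_{\xi ij}=\sum_sp_sC_{sij}$. The measure $\xi$ is pseudo symmetric if each $C_{\xi ij}$ is completely symmetric, i.e. of the form $aI_t+bJ_t$ with $J_t$ the all-ones matrix. $M^+$ denotes the Moore–Penrose inverse. $\Sigma$ is of type-H if $\Sigma=I_k+\eta1_k'+1_k\eta'$ for some $\eta\in\mathbb R^k$. For $u,w\in\mathbb R^3$ (coordinates indexed $0,1,2$) let $C_\xi[u,w]=\sum_{i,j=0}^2u_iw_jC_{\xi ij}$. Let $\mathcal T=\{x\in\mathbb R^t:1_t'x=0,\ x\ne0\}$. For $u\in\mathbb R^3$, vectors $w_1,\dots,w_m\in\mathbb R^3$ ($m\in\{1,2\}$) and $x\in\mathcal T$ define $\mathcal I_\xi(u;w_1,\dots,w_m;x)=C_\xi[u,u]-F'G^+F$, where $F$ is the $m\times t$ matrix whose $a$-th row is $(C_\xi[u,w_a]x)'$ and $G$ is the $m\times m$ matrix with entries $x'C_\xi[w_a,w_b]x$. Directional model (parameters $\lambda_1,\lambda_2$): with $\ell=(1,\lambda_1,\lambda_2)'$, $e_1=(0,1,0)'$, $e_2=(0,0,1)'$, $\ell_0=(-1,1+\lambda_2,-\lambda_2)'$, $\ell_1=(-1,-\lambda_1,1+\lambda_1)'$, the information matrices are $C_\xi(\tau)=\mathcal I_\xi(\ell;e_1,e_2;\tau)$ for the direct effect and $C_\xi(\theta)=(1+\lambda_1+\lambda_2)^{-2}\mathcal I_\xi(\ell;\ell_0,\ell_1;\theta)$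 for the total effect. Undirectional model (parameter $\lambda$): with $\ell_\lambda=(1,\lambda,\lambda)'$, $\ell_2=(0,1,1)'$, $\ell_3=(2,-1,-1)'$, the information matrices are $\tilde C_\xi(\tau)=\mathcal I_\xi(\ell_\lambda;\ell_2;\tau)$ and $\tilde C_\xi(\theta)=(1+2\lambda)^{-2}\mathcal I_\xi(\ell_\lambda;\ell_3;\theta)$. A probability distribution $g$ on $\mathcal T$ is exchangeable if the law of $Px$ equals that of $x$ for every $t\times t$ permutation matrix $P$. For a $t\times t$ nonnegative definite matrix $C$ with $C1_t=0$ and eigenvalues $0=a_0\le a_1\le\cdots\le a_{t-1}$ let $\Phi_A(C)=(t-1)(\sum_{i=1}^{t-1}a_i^{-1})^{-1}$ (interpreted as $0$ if $a_1=0$), $\Phi_D(C)=(\prod_{i=1}^{t-1}a_i)^{1/(t-1)}$, $\Phi_E(C)=a_1$, $\Phi_T(C)=(t-1)^{-1}\sum_{i=1}^{t-1}a_i$. In a given model, a measure is $\mathcal A_g$-optimal for $\tau$ (resp. $\theta$) if it maximizes $\xi\mapsto\int\Phi_A(\mathcal C_\xi(x))\,g(dx)$ over $\mathcal P$, where $\mathcal C_\xi$ is that model's information matrix for $\tau$ (resp. $\theta$); $\mathcal D_g$-, $\mathcal E_g$-, $\mathcal T_g$-optimality are defined analogously with $\Phi_D,\Phi_E,\Phi_T$. *)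

(* Defs.v *)
From HB Require Import structures.
From Stdlib Require Import ClassicalEpsilon.
From mathcomp Require Import all_boot all_order all_algebra perm.
From mathcomp Require Import all_classical all_reals all_analysis.
Set Implicit Arguments. Unset Strict Implicit. Unset Printing Implicit Defensive.
Import Order.TTheory GRing.Theory Num.Theory.
Local Open Scope classical_set_scope.
Local Open Scope ring_scope.

Section Design.
Variables (R : realType) (k t : nat).

Definition seqT := {ffun 'I_k -> 'I_t}.

Definition Tmat (s : seqT) : 'M[R]_(k, t) := \matrix_(j, i) (s j == i)%:R.

Definition Hmat : 'M[R]_k := \matrix_(i, j) ((i : nat) == (j.+1 %% k)%N)%:R.

Definition Lmat (s : seqT) : 'M[R]_(k, t) := Hmat *m Tmat s.
Definition Rmat (s : seqT) : 'M[R]_(k, t) := Hmat^T *m Tmat s.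

Definition Gmat (i : 'I_3) (s : seqT) : 'M[R]_(k, t) :=
  match val i with 0%N => Tmat s | 1%N => Lmat s | _ => Rmat s end.

Definition posdef (S : 'M[R]_k) : Prop :=
  S^T = S /\ forall v : 'cV[R]_k, v != 0 -> 0 < (v^T *m S *m v) 0 0.

Definition ones (n : nat) : 'cV[R]_n := const_mx 1.

Definition typeH (S : 'M[R]_k) : Prop :=
  exists eta : 'cV[R]_k, S = 1%:M + eta *m (ones k)^T + ones k *m eta^T.

Definition Btilde (S : 'M[R]_k) : 'M[R]_k :=
  invmx S - ((((ones k)^T *m invmx S *m ones k) 0 0)^-1)
              *: (invmx S *m ones k *m (ones k)^T *m invmx S).

Definition Cs (S : 'M[R]_k) (s : seqT) (i j : 'I_3) : 'M[R]_t :=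
  (Gmat i s)^T *m Btilde S *m Gmat j s.

Definition measure_on := {ffun seqT -> R}.
Definition is_measure (xi : measure_on) : Prop :=
  (forall s, 0 <= xi s) /\ \sum_s xi s = 1.

Definition Cxi (S : 'M[R]_k) (xi : measure_on) (i j : 'I_3) : 'M[R]_t :=
  \sum_s xi s *: Cs S s i j.

Definition completely_symmetric (M : 'M[R]_t) : Prop :=
  exists a b : R, M = a *: 1%:M + b *: const_mx 1.

Definition pseudo_symmetric (S : 'M[R]_k) (xi : measure_on) : Prop :=
  forall i j : 'I_3, completely_symmetric (Cxi S xi i j).

Definition Cuw (S : 'M[R]_k) (xi : measure_on) (u w : 'cV[R]_3) : 'M[R]_t :=
  \sum_(i < 3) \sum_(j < 3) (u i 0 * w j 0) *: Cxi S xi i j.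

End Design.

(** Moore–Penrose inverse: the unique matrix satisfying the four Penrose
    equations (over a real field, adjoint = transpose). *)
Definition penrose (R : realType) m n (A : 'M[R]_(m, n)) (X : 'M[R]_(n, m)) : Prop :=
  [/\ A *m X *m A = A, X *m A *m X = X, (A *m X)^T = A *m X & (X *m A)^T = X *m A].

Definition mpinv (R : realType) m n (A : 'M[R]_(m, n)) : 'M[R]_(n, m) :=
  epsilon (inhabits 0) (penrose A).

Section Info.
Variables (R : realType) (k t : nat) (S : 'M[R]_k) (xi : measure_on R k t).

Definition Iinfo m (u : 'cV[R]_3) (w : 'I_m -> 'cV[R]_3) (x : 'cV[R]_t) : 'M[R]_t :=
  let F : 'M[R]_(m, t) := \matrix_(a, l) ((Cuw S xi u (w a) *m x) l 0) in
  let G : 'M[R]_m := \matrix_(a, b) ((x^T *m Cuw S xi (w a) (w b) *m x) 0 0) in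
  Cuw S xi u u - F^T *m mpinv G *m F.

End Info.

Definition vec3 (R : realType) (a b c : R) : 'cV[R]_3 :=
  \col_(i < 3) [:: a; b; c]`_i.

Definition two_vecs (R : realType) (v1 v2 : 'cV[R]_3) : 'I_2 -> 'cV[R]_3 :=
  fun a => if val a == 0%N then v1 else v2.
Definition one_vec (R : realType) (v : 'cV[R]_3) : 'I_1 -> 'cV[R]_3 := fun _ => v.

Definition C_tau_dir (R : realType) k t S xi (l1 l2 : R) (x : 'cV[R]_t) : 'M[R]_t :=
  @Iinfo R k t S xi 2 (vec3 1 l1 l2) (two_vecs (vec3 0 1 0) (vec3 0 0 1)) x.

Definition C_theta_dir (R : realType) k t S xi (l1 l2 : R) (x : 'cV[R]_t) : 'M[R]_t :=
  ((1 + l1 + l2) ^- 2) *: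
  @Iinfo R k t S xi 2 (vec3 1 l1 l2)
    (two_vecs (vec3 (-1) (1 + l2) (- l2)) (vec3 (-1) (- l1) (1 + l1))) x.

Definition C_tau_undir (R : realType) k t S xi (l : R) (x : 'cV[R]_t) : 'M[R]_t :=
  @Iinfo R k t S xi 1 (vec3 1 l l) (one_vec (vec3 0 1 1)) x.

Definition C_theta_undir (R : realType) k t S xi (l : R) (x : 'cV[R]_t) : 'M[R]_t :=
  ((1 + 2 * l) ^- 2) *:
  @Iinfo R k t S xi 1 (vec3 1 l l) (one_vec (vec3 2 (-1) (-1))) x.

Definition eigs (R : realType) t (C : 'M[R]_t) : seq R :=
  epsilon (inhabits [::]) (fun s : seq R =>
    [/\ sorted <=%R s, size s = t & char_poly C = \prod_(a <- s) ('X - a%:P)]).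

Definition eig (R : realType) t (C : 'M[R]_t) (i : nat) : R := nth 0 (eigs C) i.

Inductive criterion := critA | critD | critE | critT.

Definition Phi (R : realType) t (c : criterion) (C : 'M[R]_t) : R :=
  match c with
  | critA => if eig C 1 == 0 then 0
             else (t.-1)%:R / \sum_(1 <= i < t) (eig C i)^-1
  | critD => powR (\prod_(1 <= i < t) eig C i) ((t.-1)%:R^-1)
  | critE => eig C 1
  | critT => (t.-1)%:R^-1 * \sum_(1 <= i < t) eig C i
  end.

(** vectors of R^t are t-tuples (with their product Borel sigma-algebra) *)
Definition colv (R : realType) t (x : t.-tuple R) : 'cV[R]_t := \col_i tnth x i.

Definition Tset (R : realType) t : set (t.-tuple R) :=
  [set x | (\sum_i tnth x i == 0) && [exists i, tnth x i != 0]].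

Definition permute_tuple (R : realType) t (sg : 'S_t) (x : t.-tuple R) : t.-tuple R :=
  [tuple tnth x (sg i) | i < t].

Definition distribution_on_T (R : realType) t (g : probability (t.-tuple R) R) : Prop :=
  g (@Tset R t) = 1%E.

Definition exchangeable (R : realType) t (g : probability (t.-tuple R) R) : Prop :=
  forall (sg : 'S_t) (A : set (t.-tuple R)), measurable A ->
    g (permute_tuple sg @^-1` A) = g A.

Definition crit_value (R : realType) k t (g : probability (t.-tuple R) R) (c : criterion)
  (Cinfo : measure_on R k t -> 'cV[R]_t -> 'M[R]_t) (xi : measure_on R k t) : \bar R :=
  (\int[g]_(x in @Tset R t) (Phi c (Cinfo xi (colv x)))%:E)%E.

Definition optimal (R : realType) k t (g : probability (t.-tuple R) R) (c : criterion)
  (Cinfo : measure_on R k t -> 'cV[R]_t -> 'M[R]_t) (xi : measure_on R k t) : Prop :=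
  is_measure xi /\
  forall xi' : measure_on R k t, is_measure xi' ->
    (crit_value g c Cinfo xi' <= crit_value g c Cinfo xi)%E.

(* Main.v *)
Require Import Defs.
From HB Require Import structures.
From mathcomp Require Import all_boot all_order all_algebra perm.
From mathcomp Require Import complex spectral.
From mathcomp Require Import all_classical all_reals all_analysis.
From mathcomp Require Import measurable_realfun ring lra.
From Stdlib Require ClassicalEpsilon.
Import Order.TTheory GRing.Theory Num.Theory.
Local Open Scope ring_scope.
Set Implicit Arguments. Unset Strict Implicit. Unset Printing Implicit Defensive.

(* Under type-H, [Btilde S] is the projection orthogonal to the ones vector, which
   commutes with the cyclic shift [Hmat].  Hence the quadratic form
   [q v = tr C_xi[v, v] / (t - 1)] on R^3 is positive semidefinite and invariant
   under exchanging the coordinates of the left and right neighbour effects.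

   By a Gram factorisation, [x' I_xi(u; w; x) x] is the minimum of
   [x' C_xi[v, v] x] over the affine space [v in u + span w].  For pseudo symmetric
   [xi] the information matrix therefore has eigenvalue 0 on the ones vector,
   [q_min] (the minimum of [q] on that affine space) on [x], and [q u] on the rest.
   The affine spaces of the undirectional models are the exchange-invariant points of
   those of the directional models (up to scaling, for the total effect), so by
   convexity [q_min] agrees; and [q u] agrees when [l1 = l2 = l].

   It remains to see that any measure is dominated by its symmetrisation over
   relabellings of the treatments.  Each criterion has a linear majorant
   [Phi C <= al * x'Cx / x'x + be * (tr C - x'Cx / x'x)], exact at the symmetrised
   measure, and exchangeability of [g] allows averaging it over all
   permutations of [x]. *)

(** * Spectral decomposition and sorted eigenvalues of real symmetric matrices *)

Lemma char_poly_conj (F : fieldType) n (U A : 'M[F]_n) :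
  U \in unitmx -> char_poly (invmx U *m A *m U) = char_poly A.
Proof.
move=> Uu; rewrite /char_poly /char_poly_mx.
have -> : 'X%:M - map_mx polyC (invmx U *m A *m U) =
  map_mx polyC (invmx U) *m ('X%:M - map_mx polyC A) *m map_mx polyC U.
  rewrite mulmxBr mulmxBl -!map_mxM; congr (_ - _).
  by rewrite scalar_mxC -mulmxA -map_mxM mulVmx // map_mx1 mulmx1.
rewrite !det_mulmx mulrC mulrA -det_mulmx -map_mxM mulmxV //.
by rewrite map_mx1 det1 mul1r.
Qed.

(* The unitary diagonalisation over [R[i]], written with the real part [P] and
   the imaginary part [Q] of the unitary matrix. *)
Lemma symmetric_spectral (R : rcfType) n (M : 'M[R]_n) : M^T = M ->
  exists (d : 'rV[R]_n) (P Q : 'M[R]_n),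
  [/\ char_poly M = \prod_i ('X - (d 0 i)%:P),
      P^T *m P + Q^T *m Q = 1%:M, P^T *m Q = Q^T *m P,
      M = P^T *m diag_mx d *m P + Q^T *m diag_mx d *m Q &
      diag_mx d = P *m M *m P^T + Q *m M *m Q^T].
Proof.
move=> Msym.
pose c := real_complex R; pose MC := map_mx c M.
have MCh : MC \is hermsymmx.
  apply: realsym_hermsym.
    apply/is_hermitianmxP; rewrite expr0 scale1r map_mx_id //.
    by rewrite /MC map_trmx Msym.
  by apply/mxOverP => i j; rewrite mxE; apply/complex_realP; exists (M i j).
have MCe := orthomx_spectralP (hermitian_normalmx MCh).
have Dr := hermitian_spectral_diag_real MCh.
have Uu := spectral_unitarymx MC.
set U := spectralmx MC in MCe Uu; set sp := spectral_diag MC in MCe Dr.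
pose d : 'rV[R]_n := map_mx (@complex.Re R) sp.
have spE : sp = map_mx c d.
  apply/matrixP => i j; rewrite !mxE /c /=.
  by rewrite RRe_real //; move/mxOverP: Dr; apply.
have Uunit := unitarymx_unit Uu.
pose Ut := map_mx Num.conj (U^T).
have UU : U *m Ut = 1%:M by apply/unitarymxP.
have UV : invmx U = Ut by rewrite invmx_unitary.
have UtU : Ut *m U = 1%:M by rewrite -UV mulVmx.
pose P := map_mx (@complex.Re R) U; pose Q := map_mx (@complex.Im R) U.
pose J : R[i] := 'i%C.
have UE : U = map_mx c P + J *: map_mx c Q.
  by apply/matrixP => i j; rewrite !mxE /J /c /= -complexE.
have UtE : Ut = map_mx c P^T - J *: map_mx c Q^T.
  apply/matrixP => i j; rewrite !mxE /J /c /=; case: (U j i) => a b.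
  by rewrite /GRing.mul /GRing.opp /GRing.add /=; simpc.
have JJ : J * J = -1 by rewrite -expr2 sqr_i.
(* Comparing real and imaginary parts turns each matrix identity over [R[i]] into two real ones. *)
have inj (A B A' B' : 'M[R]_n) :
    map_mx c A + J *: map_mx c B = map_mx c A' + J *: map_mx c B' ->
    A = A' /\ B = B'.
  move=> e; split; apply/matrixP => i j; move/matrixP/(_ i j): e;
  by rewrite !mxE /J /c /=; simpc; case.
have expand (A B A' B' X : 'M[R]_n) :
    (map_mx c A - J *: map_mx c B) *m map_mx c X *m (map_mx c A' + J *: map_mx c B')
    = map_mx c (A *m X *m A' + B *m X *m B') + J *: map_mx c (A *m X *m B' - B *m X *m A').
  rewrite !(mulmxDl, mulmxDr, mulNmx) -!scalemxAl -!scalemxAr scalerA JJ !scaleN1r.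
  rewrite -!map_mxM !map_mxD !map_mxN scalerDr scalerN opprK.
  by rewrite [X in _ + X = _]addrC addrACA [X in _ + X = _]addrC.
have expand' (A B A' B' X : 'M[R]_n) :
    (map_mx c A + J *: map_mx c B) *m map_mx c X *m (map_mx c A' - J *: map_mx c B')
    = map_mx c (A *m X *m A' + B *m X *m B') + J *: map_mx c (B *m X *m A' - A *m X *m B').
  have := expand A (- B) A' (- B') X.
  rewrite !(map_mxN, scalerN, opprK) => ->; rewrite !(mulNmx, mulmxN, opprK).
  by congr (_ + J *: map_mx _ _); rewrite addrC.
have [h1 h2] : P^T *m 1%:M *m P + Q^T *m 1%:M *m Q = 1%:M /\
    P^T *m 1%:M *m Q - Q^T *m 1%:M *m P = 0.
  apply: inj; rewrite -expand -UE -UtE map_mx1 mulmx1 UtU.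
  by rewrite map_mx0 scaler0 addr0.
have [h3 _] : M = P^T *m diag_mx d *m P + Q^T *m diag_mx d *m Q /\
    0 = P^T *m diag_mx d *m Q - Q^T *m diag_mx d *m P.
  apply: inj; rewrite -expand -UE -UtE map_diag_mx -spE map_mx0 scaler0 addr0.
  by rewrite -/MC [LHS]MCe UV.
have [h4 _] : diag_mx d = P *m M *m P^T + Q *m M *m Q^T /\
    0 = Q *m M *m P^T - P *m M *m Q^T.
  apply: inj; rewrite -expand' -UE -UtE map_diag_mx -spE map_mx0 scaler0 addr0.
  by rewrite -/MC [in RHS]MCe -UV !mulmxA mulmxV // mul1mx mulmxK.
exists d, P, Q; split=> //.
(* The factorisation is checked over [R[i]], where [M] is similar to a diagonal matrix, and
   reflected along the injective embedding of [R]. *)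
- apply: (map_inj_poly (@complexI R)); first by [].
  rewrite -/c map_char_poly -/MC MCe char_poly_conj // char_poly_trig; last first.
    exact: diag_mx_is_trig.
  rewrite rmorph_prod; apply: eq_bigr => i _.
  by rewrite rmorphB /= map_polyX map_polyC /= spE !mxE eqxx mulr1n.
- by rewrite !mulmx1 in h1.
- by rewrite !mulmx1 in h2; apply/eqP; rewrite -subr_eq0 h2.
Qed.

Definition qform (R : realType) n (M : 'M[R]_n) (v : 'cV[R]_n) : R :=
  (v^T *m M *m v) 0 0.

Definition psd (R : realType) n (M : 'M[R]_n) : Prop :=
  M^T = M /\ forall v : 'cV[R]_n, 0 <= qform M v.

Lemma qformD (R : realType) n (A B : 'M[R]_n) v :
  qform (A + B) v = qform A v + qform B v.
Proof. by rewrite /qform mulmxDr mulmxDl mxE. Qed.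

Section Eigenvalues.
Variables (R : realType) (t : nat).
Implicit Types (C : 'M[R]_t) (v x : 'cV[R]_t).

(** The factorisation determines the roots up to order and sortedness fixes the order, so the choice
    made in [eigs] has a single candidate. *)
Lemma eigs_unique C (s : seq R) : sorted <=%R s -> size s = t ->
  char_poly C = \prod_(a <- s) ('X - a%:P) -> eigs C = s.
Proof.
move=> ss zs cs.
have [ss' _ cs'] := ClassicalEpsilon.epsilon_spec (inhabits [::]) (fun s : seq R =>
    [/\ sorted <=%R s, size s = t & char_poly C = \prod_(a <- s) ('X - a%:P)])
    (ex_intro _ s (And3 ss zs cs)).
apply: (sorted_eq le_trans le_anti ss' ss).
by apply: prod_XsubC_eq; rewrite -cs -cs'.
Qed.

(** [eigs C] is a sorted rearrangement of the spectral coefficients; applying the same permutation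
    to the rows of [P] and [Q] keeps all relations. *)
Lemma eig_spectral C : C^T = C ->
  exists P Q : 'M[R]_t, let D := diag_mx (\row_i eig C i) in
  [/\ P^T *m P + Q^T *m Q = 1%:M, P^T *m Q = Q^T *m P,
      C = P^T *m D *m P + Q^T *m D *m Q,
      D = P *m C *m P^T + Q *m C *m Q^T &
      sorted <=%R (eigs C) /\ size (eigs C) = t].
Proof.
move=> Csym; have [d [P [Q [cC h1 h2 h3 h4]]]] := symmetric_spectral Csym.
pose u := [tuple d 0 i | i < t].
have ss : sorted <=%R (sort <=%R u) by apply: sort_sorted; exact: le_total.
have eE : eigs C = sort <=%R u.
  apply: eigs_unique => //; first by rewrite size_sort size_tuple.
  rewrite cC (perm_big u) /=; last by rewrite perm_sort.
  by rewrite /u /= big_map big_enum.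
have : perm_eq (sort <=%R u) u by rewrite perm_sort.
case/tuple_permP => p pE.
have eigE (i : 'I_t) : eig C i = d 0 (p i).
  rewrite /eig eE pE (nth_map i) ?size_enum_ord // nth_ord_enum.
  by rewrite tnth_mktuple.
have DE : diag_mx (\row_i eig C i) = perm_mx p *m diag_mx d *m (perm_mx p)^T.
  rewrite -row_permE tr_perm_mx -col_permE.
  apply/matrixP => i j; rewrite !mxE eigE.
  by rewrite (inj_eq perm_inj).
have pp : (perm_mx p)^T *m perm_mx p = 1%:M :> 'M[R]_t.
  by rewrite tr_perm_mx -perm_mxM mulVg perm_mx1.
exists (perm_mx p *m P), (perm_mx p *m Q); split.
- by rewrite !trmx_mul !mulmxA -(mulmxA P^T) -(mulmxA Q^T) pp !mulmx1.
- by rewrite !trmx_mul !mulmxA -(mulmxA P^T) -(mulmxA Q^T) pp !mulmx1.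
- rewrite DE !trmx_mul !mulmxA -[P^T *m _ *m _]mulmxA -[Q^T *m _ *m _]mulmxA pp !mulmx1.
  by rewrite -[P^T *m _ *m _ *m _]mulmxA -[Q^T *m _ *m _ *m _]mulmxA pp !mulmx1.
- rewrite DE h4 !trmx_mul mulmxDr mulmxDl !mulmxA //.
- by rewrite eE ss size_sort size_tuple.
Qed.

Lemma qform_sum n v (P : 'M[R]_(n, t)) (e : 'rV[R]_n) :
  qform (P^T *m diag_mx e *m P) v = \sum_i e 0 i * ((P *m v) i 0) ^+ 2.
Proof.
rewrite /qform !mulmxA -trmx_mul -mulmxA mxE.
apply: eq_bigr => i _; rewrite mul_mx_diag !mxE; ring.
Qed.

Lemma eig_ge0 C i : psd C -> 0 <= eig C i.
Proof.
move=> [Csym Cpsd]; have [P [Q [_ _ _ h4 [_ hz]]]] := eig_spectral Csym.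
have [it|ti] := ltnP i t; last by rewrite /eig nth_default // hz.
have -> : eig C i = diag_mx (\row_i eig C i) (Ordinal it) (Ordinal it).
  by rewrite !mxE eqxx mulr1n.
have diag_ge0 (N : 'M[R]_t) j : 0 <= (N *m C *m N^T) j j.
  apply: le_trans (Cpsd (row j N)^T) _; rewrite /qform trmxK -!row_mul.
  by rewrite !mxE; apply: ler_sum => k _; rewrite !mxE.
by rewrite h4 mxE addr_ge0.
Qed.

Lemma qform1E v : qform 1%:M v = \sum_i (v i 0) ^+ 2.
Proof. by rewrite /qform mulmx1 mxE; apply: eq_bigr => i _; rewrite mxE. Qed.

Lemma qform1_gt0 v : v != 0 -> 0 < qform 1%:M v.
Proof.
move=> v0; rewrite qform1E lt_def sumr_ge0 ?andbT; last by move=> i _; apply: sqr_ge0.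
apply: contra v0; rewrite psumr_eq0; last by move=> i _; apply: sqr_ge0.
move=> /allP h; apply/eqP/colP => i; rewrite mxE; apply/eqP.
by have := h i (mem_index_enum _); rewrite sqrf_eq0.
Qed.

(** In the eigenbasis each eigenvalue is at most the sum of all of them, since none is negative. *)
Lemma psd_le_trace C v : psd C -> qform C v <= \tr C * qform 1%:M v.
Proof.
move=> Cp; have [P [Q [h1 _ h3 h4 _]]] := eig_spectral (proj1 Cp).
set e := \row_i eig C i in h3 h4.
have trE : \tr C = \sum_(i < t) eig C i.
  transitivity (\tr (diag_mx e)); last first.
    by rewrite mxtrace_diag; apply: eq_bigr => i _; rewrite mxE.
  rewrite h4 mxtraceD [X in X + _]mxtrace_mulC [X in _ + X]mxtrace_mulC.
  by rewrite !mulmxA -mxtraceD -mulmxDl h1 mul1mx.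
have -> : qform 1%:M v = qform (P^T *m diag_mx (const_mx 1) *m P) v +
                         qform (Q^T *m diag_mx (const_mx 1) *m Q) v.
  by rewrite -qformD !diag_const_mx !mulmx1 h1.
rewrite {1}h3 qformD !qform_sum mulrDr !mulr_sumr.
by apply: lerD; apply: ler_sum => i _; rewrite !mxE mul1r ler_wpM2r ?sqr_ge0 // trE
  (bigD1 i) //= lerDl sumr_ge0 // => j _; apply: eig_ge0.
Qed.

End Eigenvalues.

Section EigData.
Variables (R : realType) (n : nat).
Local Notation t := n.+1.
Implicit Types (C : 'M[R]_t) (v x : 'cV[R]_t).

(** The weights [s i] are the squared moduli of the coordinates of [x] in the unitary eigenbasis,
    divided by [x'x]. If [eig C 1] is positive, the kernel of [C] is the line of the ones vector, so
    [x] has no weight at index 0. Otherwise that weight need not vanish, hence the alternative. *)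
Lemma eig_data C x : psd C -> C *m const_mx 1 = 0 :> 'cV_t ->
  (const_mx 1 : 'rV_t) *m x = 0 -> x != 0 ->
  [/\ forall i, 0 <= eig C i, forall i, (1 <= i < t)%N -> eig C 1 <= eig C i,
      \sum_(1 <= i < t) eig C i = \tr C &
      eig C 1 = 0 \/ exists s : nat -> R,
        [/\ forall i, 0 <= s i, \sum_(1 <= i < t) s i = 1 &
            \sum_(1 <= i < t) s i * eig C i = qform C x / qform 1%:M x]].
Proof.
move=> [Csym Cpsd] C1 x1 x0.
have [P [Q [h1 h2 h3 h4 [hs hz]]]] := eig_spectral Csym.
set e := \row_i eig C i in h3 h4.
have eig_ge0 i : 0 <= eig C i := eig_ge0 i (conj Csym Cpsd).
have mono i j : (i <= j)%N -> (j < t)%N -> eig C i <= eig C j.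
  move=> ij jt; rewrite /eig; apply: (sorted_leq_nth le_trans le_refl) => //.
    by rewrite inE hz (leq_ltn_trans ij).
  by rewrite inE hz.
pose w v i := ((P *m v) i 0) ^+ 2 + ((Q *m v) i 0) ^+ 2.
have wE v : qform C v = \sum_(i < t) eig C i * w v i.
  rewrite {1}h3 qformD !qform_sum -big_split /=.
  by apply: eq_bigr => i _; rewrite mxE -mulrDr.
have w1 v : qform 1%:M v = \sum_i w v i.
  have -> : 1%:M = P^T *m diag_mx (const_mx 1) *m P + Q^T *m diag_mx (const_mx 1) *m Q.
    by rewrite !diag_const_mx !mulmx1.
  rewrite qformD !qform_sum -big_split /=.
  by apply: eq_bigr => i _; rewrite mxE !mul1r.
have w_ge0 v i : 0 <= w v i by rewrite addr_ge0 ?sqr_ge0.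
have big_split0 (F : nat -> R) : \sum_(i < t) F i = F 0%N + \sum_(1 <= i < t) F i.
  by rewrite -(big_mkord predT F) big_ltn.
pose one : 'cV[R]_t := const_mx 1.
have trone : one^T = const_mx 1 by rewrite /one trmx_const.
have w_one i : eig C (i : 'I_t) * w one i = 0.
  have /eqP : \sum_(i < t) eig C i * w one i = 0.
    by rewrite -wE /qform -mulmxA C1 mulmx0 mxE.
  rewrite psumr_eq0; last by move=> j _; rewrite mulr_ge0.
  by move=> /allP /(_ i (mem_index_enum _)) /eqP.
have one0 : one != 0.
  by apply/eqP => /colP /(_ 0); rewrite !mxE; apply/eqP; rewrite oner_eq0.
(* Otherwise all eigenvalues are nonzero, and the ones vector, being killed by [C], would have no
   weight at any index. *)
have eig0 : eig C 0 = 0.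
  apply/eqP; apply: contraT => e0; have := qform1_gt0 one0.
  rewrite w1 big1 ?ltxx // => i _; have /eqP := w_one i.
  rewrite mulf_eq0 => /orP[/eqP ei|/eqP //]; case/eqP: e0.
  by apply/le_anti; rewrite eig_ge0 andbT -ei; apply: mono.
split=> //.
- by move=> i /andP[i1 it]; apply: mono.
- rewrite -[LHS]add0r -{1}eig0 -big_split0.
  have <- : \tr (diag_mx e) = \sum_(i < t) eig C i.
    by rewrite mxtrace_diag; apply: eq_bigr => i _; rewrite mxE.
  rewrite h4 mxtraceD [X in X + _]mxtrace_mulC [X in _ + X]mxtrace_mulC.
  by rewrite !mulmxA -mxtraceD -mulmxDl h1 mul1mx.
have [->|e1] := eqVneq (eig C 1) 0; [by left|right].
have e1p : 0 < eig C 1 by rewrite lt_def e1 eig_ge0.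
have wi0 (i : 'I_t) : (0 < i)%N -> (P *m one) i 0 = 0 /\ (Q *m one) i 0 = 0.
  move=> i0; have /eqP := w_one i; rewrite mulf_eq0 => /orP[/eqP ei|].
    have := lt_le_trans e1p (mono 1%N i i0 (ltn_ord i)).
    by rewrite ei ltxx.
  rewrite /w paddr_eq0 ?sqr_ge0 // !sqrf_eq0 => /andP[/eqP -> /eqP ->] //.
have dot (A B : 'M[R]_t) :
    (x^T *m (A^T *m B) *m one) 0 0 = \sum_i (A *m x) i 0 * (B *m one) i 0.
  rewrite mulmxA -trmx_mul -mulmxA mxE; apply: eq_bigr => i _.
  by rewrite mxE.
have x_one : x^T *m one = 0.
  by apply: (can_inj (@trmxK _ _ _)); rewrite trmx_mul trmxK trone x1 trmx0.
(* Only index 0 contributes. [eq1] and [eq2] say that the coordinate of the ones vector times the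
   conjugate coordinate of [x] has zero real and imaginary part; multiplicativity of the squared
   modulus then gives [w0]. *)
have eq1 : (P *m x) 0 0 * (P *m one) 0 0 + (Q *m x) 0 0 * (Q *m one) 0 0 = 0.
  have : (x^T *m (P^T *m P + Q^T *m Q) *m one) 0 0 = 0.
    by rewrite h1 mulmx1 x_one mxE.
  rewrite mulmxDr mulmxDl mxE !dot !big_ord_recl !big1 ?addr0 // => i _;
  by have [z1 z2] := wi0 (lift ord0 i) isT; rewrite ?z1 ?z2 mulr0.
have eq2 : (P *m x) 0 0 * (Q *m one) 0 0 = (Q *m x) 0 0 * (P *m one) 0 0.
  have : (x^T *m (P^T *m Q) *m one) 0 0 = (x^T *m (Q^T *m P) *m one) 0 0.
    by rewrite h2.
  rewrite !dot !big_ord_recl !big1 ?addr0 // => i _;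
  by have [z1 z2] := wi0 (lift ord0 i) isT; rewrite ?z1 ?z2 mulr0.
have w0 : w x 0 = 0.
  have : w x 0 * w one 0 = 0.
    rewrite /w; move: eq1 eq2; set a := (P *m x) 0 0; set b := (Q *m x) 0 0.
    set c := (P *m one) 0 0; set d := (Q *m one) 0 0 => q1 q2.
    transitivity ((a * c + b * d) ^+ 2 + (a * d - b * c) ^+ 2); first by ring.
    by rewrite q1 q2 subrr !expr0n addr0.
  move/eqP; rewrite mulf_eq0 => /orP[/eqP //|/eqP wo].
  have := qform1_gt0 one0; rewrite w1 big_ord_recl wo big1 ?addr0 ?ltxx // => i _.
  by rewrite /w; have [-> ->] := wi0 (lift ord0 i) isT; rewrite !expr0n addr0.
have x2 := qform1_gt0 x0.
(* [inord] only makes the weights a function on [nat]; its default value never enters the sums. *)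
exists (fun i => w x (inord i) / qform 1%:M x); split.
- by move=> i; rewrite divr_ge0 // ltW.
- rewrite -mulr_suml -[X in X / _]add0r -{1}w0.
  have -> : w x 0 = w x (inord 0) by congr (w x _); apply: val_inj; rewrite /= inordK.
  rewrite -(big_split0 (fun i => w x (inord i))).
  under eq_bigr do rewrite inord_val.
  by rewrite -w1 divff // gt_eqF.
- rewrite wE mulr_suml.
  rewrite (eq_bigr (fun i : 'I_t => w x (inord i) / qform 1%:M x * eig C i)); last first.
    by move=> i _; rewrite inord_val; ring.
  by rewrite (big_split0 (fun i => w x (inord i) / qform 1%:M x * eig C i)) eig0 mulr0 add0r.
Qed.
End EigData.

(** * Supporting lines of the harmonic and geometric means *)

Section SupportingLines.
Variables (R : realType) (I : finType) (e s : I -> R) (a b : R).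
Hypotheses (a0 : 0 < a) (b0 : 0 < b).
Hypotheses (e0 : forall i, 0 < e i) (s0 : forall i, 0 <= s i).
Hypothesis s1 : \sum_i s i = 1.

Lemma weight_le1 i : s i <= 1.
Proof. by rewrite -s1 (bigD1 i) //= lerDl sumr_ge0. Qed.

Lemma sum_mix (u v : R) :
  \sum_i (s i * u + (1 - s i) * v) = u + (#|I|%:R - 1) * v.
Proof.
rewrite big_split /= -!mulr_suml s1 mul1r sumrB s1.
by rewrite sumr_const.
Qed.

Lemma card_natr_gt0 : 0 < #|I|%:R :> R.
Proof.
rewrite ltr0n; apply/card_gt0P; apply: contrapT => h.
move: s1; rewrite big1 => [/esym/eqP|i _]; first by rewrite oner_eq0.
by exfalso; apply: h; exists i.
Qed.

(* Convexity of the square bounds the weights below by the squares of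
   [z i := s i / a + (1 - s i) / b], and [e z ^+ 2 >= 2 c z - c ^+ 2 / e]
   is summed at the optimal [c]. *)
Lemma harmonic_support (D := a^-1 + (#|I|%:R - 1) * b^-1) :
  D ^+ 2 / \sum_i (e i)^-1 <=
  \sum_i e i * (s i * a^-1 ^+ 2 + (1 - s i) * b^-1 ^+ 2).
Proof.
set h := \sum_i (e i)^-1.
have h0 : 0 < h.
  have := card_natr_gt0; rewrite ltr0n => /card_gt0P[i _].
  rewrite /h (bigD1 i) //= ltr_pwDl ?invr_gt0 // sumr_ge0 // => j _.
  by rewrite invr_ge0 ltW.
pose c := D / h.
have -> : D ^+ 2 / h = 2 * c * D - c ^+ 2 * h.
  by rewrite /c; field; rewrite gt_eqF.
rewrite /D -sum_mix mulr_sumr mulr_sumr -sumrB; apply: ler_sum => i _.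
set z := s i * a^-1 + _; have ei := e0 i; have ein : e i != 0 by rewrite gt_eqF.
have h1 : z ^+ 2 <= s i * a^-1 ^+ 2 + (1 - s i) * b^-1 ^+ 2.
  rewrite -subr_ge0.
  have -> : s i * a^-1 ^+ 2 + (1 - s i) * b^-1 ^+ 2 - z ^+ 2 =
            s i * (1 - s i) * (a^-1 - b^-1) ^+ 2 by rewrite /z; ring.
  by rewrite mulr_ge0 ?sqr_ge0 // mulr_ge0 // subr_ge0 weight_le1.
apply: le_trans (ler_wpM2l (ltW ei) h1).
rewrite -subr_ge0; have -> : e i * z ^+ 2 - (2 * c * z - c ^+ 2 * (e i)^-1) =
  (e i * z - c) ^+ 2 / e i by field.
by rewrite divr_ge0 ?sqr_ge0 // ltW.
Qed.

Lemma ln_le_sub1 (x : R) : 0 < x -> ln x <= x - 1.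
Proof.
move=> x0; have := @le_ln1Dx R (x - 1).
by rewrite [1 + _]addrC subrK; apply; rewrite ltrBrDl subrr.
Qed.

(* [ln y <= y - 1] at [y = e i / (a M)] with weight [s i] and at
   [y = e i / (b M)] with weight [1 - s i], where [M] is the mean on the right. *)
Lemma geometric_support (m := #|I|%:R : R) :
  powR (\prod_i e i) m^-1 <=
  powR (a * b ^+ (#|I|.-1)) m^-1 * (m^-1 * \sum_i e i * (s i * a^-1 + (1 - s i) * b^-1)).
Proof.
have m0 : 0 < m := card_natr_gt0.
set M := m^-1 * _.
have w0 i : 0 < s i * a^-1 + (1 - s i) * b^-1.
  have [->|si] := eqVneq (s i) 0; first by rewrite mul0r add0r subr0 mul1r invr_gt0.
  apply: ltr_pwDl; first by rewrite mulr_gt0 ?invr_gt0 // lt_def si s0.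
  by rewrite mulr_ge0 ?subr_ge0 ?weight_le1 // invr_ge0 ltW.
have M0 : 0 < M.
  rewrite mulr_gt0 ?invr_gt0 //; have := card_natr_gt0; rewrite ltr0n => /card_gt0P[i _].
  rewrite (bigD1 i) //= ltr_pwDl ?mulr_gt0 // sumr_ge0 // => j _.
  by rewrite mulr_ge0 // ltW.
have key : \sum_i ln (e i) <= ln a + (m - 1) * ln b + m * ln M.
  have hi i : ln (e i) - (s i * ln a + (1 - s i) * ln b) - ln M <=
              e i * (s i * a^-1 + (1 - s i) * b^-1) / M - 1.
    have h u : 0 < u -> ln (e i) - ln u - ln M <= e i / u / M - 1.
      move=> u0; have -> : ln (e i) - ln u - ln M = ln (e i / u / M).
        by rewrite !ln_div ?posrE ?divr_gt0.
      by apply: ln_le_sub1; rewrite !divr_gt0.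
    have ha := ler_wpM2l (s0 i) (h _ a0).
    have hb : (1 - s i) * _ <= (1 - s i) * _ := ler_wpM2l _ (h _ b0).
    have {hb} := hb ltac:(by rewrite subr_ge0 weight_le1).
    lra.
  have := @ler_sum _ _ (index_enum I) xpredT _ _ (fun i _ => hi i).
  rewrite !sumrB sum_mix !sumr_const -mulr_suml.
  have -> : \sum_i e i * (s i * a^-1 + (1 - s i) * b^-1) = m * M.
    by rewrite /M mulVKf // gt_eqF.
  rewrite mulfK ?gt_eqF // -[ln M *+ _]mulr_natl -/m subrr; lra.
have prodE : \prod_i e i = expR (\sum_i ln (e i)).
  by rewrite expR_sum; apply: eq_bigr => i _; rewrite lnK // posrE.
have abE : a * b ^+ #|I|.-1 = expR (ln a + (m - 1) * ln b).
  have -> : m - 1 = #|I|.-1%:R.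
    by rewrite -subn1 natrB // -(ltr0n R).
  by rewrite expRD expRM_natl !lnK // posrE.
have -> : M = expR (ln M) by rewrite lnK // posrE.
rewrite prodE abE -!expRM -expRD ler_expR -ler_pdivlMr ?invr_gt0 // invrK.
by rewrite mulrDl mulfVK ?gt_eqF // [X in _ <= _ + X]mulrC.
Qed.
End SupportingLines.

(** Multiplying [M] by a block triangular matrix on the right or on the left makes it block
    triangular. Powers of [z] stand in for a division, so that [z] may be a polynomial. *)
Lemma det_sylvester (F : comNzRingType) m n (A : 'M[F]_(m, n)) (B : 'M[F]_(n, m)) (z : F) :
  (\det (z%:M + A *m B)) * z ^+ n = z ^+ m * (\det (z%:M + B *m A)).
Proof.
pose M := block_mx z%:M A (- B) (1%:M : 'M[F]_n).
have h1 : \det M = \det (z%:M + A *m B).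
  have : M *m block_mx (1%:M : 'M[F]_m) 0 B (1%:M : 'M[F]_n) =
    block_mx (z%:M + A *m B) A 0 (1%:M : 'M[F]_n).
    rewrite mulmx_block !mulmx1 !mul1mx !mulmx0 !add0r.
    by rewrite addNr.
  move/(congr1 (@determinant _ _)); rewrite det_mulmx det_lblock det_ublock.
  by rewrite !det1 !mulr1.
have : block_mx (1%:M : 'M[F]_m) 0 B (z%:M : 'M[F]_n) *m M =
    block_mx z%:M A 0 (z%:M + B *m A).
  rewrite mulmx_block !mulmx1 !mul1mx !mul0mx !addr0 mulmxN scalar_mxC.
  by rewrite subrr [B *m A + _]addrC.
move/(congr1 (@determinant _ _)); rewrite det_mulmx det_lblock det_ublock.
by rewrite !det1 !mul1r !det_scalar h1 mulrC.
Qed.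

(** * The four criteria, their values at two-level spectra and their linear majorants *)

Section Criteria.
Variables (R : realType) (n : nat).
Local Notation t := n.+2.
Implicit Types (C : 'M[R]_t) (x : 'cV[R]_t) (c : criterion) (a b : R).

(* The value of a criterion at the spectrum [0, a, b, ..., b] with [a <= b]. *)
Definition phi2 c a b : R :=
  match c with
  | critA => if a == 0 then 0 else n.+1%:R / (a^-1 + n%:R * b^-1)
  | critD => powR (a * b ^+ n) (n.+1%:R^-1)
  | critE => a
  | critT => n.+1%:R^-1 * (a + n%:R * b)
  end.

Definition contrast x := (const_mx 1 : 'rV[R]_t) *m x = 0 /\ x != 0.

Definition centering : 'M[R]_t := 1%:M - (t%:R)^-1 *: const_mx 1.

(** For a contrast [x], this has eigenvalue 0 on the ones vector, [a] on [x] and [b] on all vectors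
    orthogonal to both. *)
Definition two_level a b x : 'M[R]_t :=
  b *: centering - ((b - a) / qform 1%:M x) *: (x *m x^T).

(** The matrix is [b%:M - A *m B] with inner dimension 2, so [det_sylvester] at [z = 'X - b] reduces
    the characteristic polynomial to a 2 by 2 determinant, which is diagonal because [x] is
    orthogonal to the ones vector. *)
Lemma eigs_two_level a b x : contrast x -> 0 <= a -> a <= b ->
  eigs (two_level a b x) = [:: 0, a & nseq n b].
Proof.
move=> [x1 x0] a0 ab; have q0 := qform1_gt0 x0.
apply: eigs_unique; rewrite /= ?size_nseq //.
  rewrite a0 /=; elim: (n) a ab {a0} => //= m IH a ab.
  by rewrite ab; apply: IH.
set q := qform _ x in q0.
pose A : 'M[R]_(t, 1 + 1) := row_mx (const_mx 1) x.
pose B : 'M[R]_(1 + 1, t) := col_mx ((b / t%:R) *: const_mx 1) (((b - a) / q) *: x^T).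
have CE : two_level a b x = b%:M - A *m B.
  rewrite mul_row_col /two_level /centering -/q scalerBr scalemx1 opprD addrA.
  congr (_ - _ - _); last by rewrite -scalemxAr.
  rewrite -scalemxAr scalerA; congr (_ *: _).
  by apply/matrixP => i j; rewrite !mxE big_ord1 !mxE mulr1.
have BA : B *m A = block_mx b%:M 0 0 (b - a)%:M.
  rewrite mul_col_row -!scalemxAl x1 scaler0; congr block_mx.
  - apply/matrixP => i j; rewrite !ord1 !mxE (eq_bigr (fun=> 1)); last first.
      by move=> k _; rewrite !mxE mulr1.
    by rewrite sumr_const card_ord mulfVK // pnatr_eq0.
  - have -> : x^T *m const_mx 1 = 0 :> 'M[R]_1.
      by apply: trmx_inj; rewrite trmx_mul trmxK trmx_const x1 trmx0.
    by rewrite scaler0.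
  - apply/matrixP => i j; rewrite !ord1 mxE.
    have -> : (x^T *m x) 0 0 = q by rewrite /q /qform mulmx1.
    by rewrite mulfVK ?gt_eqF // mxE.
set z : {poly R} := 'X - b%:P.
have zE : char_poly_mx (two_level a b x) = z%:M + map_mx polyC A *m map_mx polyC B.
  rewrite /char_poly_mx CE map_mxB map_scalar_mx map_mxM /z.
  by rewrite opprB addrA [in RHS]raddfB /= addrAC.
have z0 : z ^+ 2 != 0 by rewrite expf_neq0 // polyXsubC_eq0.
apply: (mulIf z0); rewrite /char_poly zE (det_sylvester _ _ z) -map_mxM BA.
rewrite map_block_mx !map_scalar_mx !map_mx0 (_ : z%:M = block_mx z%:M 0 0 z%:M); last first.
  by rewrite -scalar_mx_block.
rewrite add_block_mx !addr0 det_ublock -!raddfD !det_scalar !expr1.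
rewrite !big_cons big_nseq -/z polyC0 subr0.
rewrite /= iter_mulr_1 polyCB (_ : z + b%:P = 'X) ?subrK //.
by rewrite (_ : z + (b%:P - a%:P) = 'X - a%:P) ?addrA ?subrK // !exprS; ring.
Qed.

Lemma sum_eig C (F : R -> R) :
  \sum_(1 <= i < t) F (eig C i) = \sum_(i < n.+1) F (eig C i.+1).
Proof. by rewrite big_add1 /= big_mkord. Qed.

Lemma Phi_two_level c a b x : contrast x -> 0 <= a -> a <= b ->
  Phi c (two_level a b x) = phi2 c a b.
Proof.
move=> hx a0 ab; have eE := eigs_two_level hx a0 ab.
have e1 : eig (two_level a b x) 1 = a by rewrite /eig eE.
have eS (i : 'I_n) : eig (two_level a b x) (lift ord0 i).+1 = b.
  by rewrite /eig eE /= nth_nseq ltn_ord.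
case: c => //=.
- rewrite e1 /phi2; case: eqP => // _.
  rewrite (sum_eig _ (fun z => z^-1)) big_ord_recl e1; congr (_ / (_ + _)).
  under eq_bigr do rewrite eS.
  by rewrite sumr_const card_ord mulr_natl.
- rewrite big_add1 /= big_mkord big_ord_recl e1; congr (powR (_ * _) _).
  under eq_bigr do rewrite eS.
  by rewrite prodr_const card_ord.
- rewrite (sum_eig _ id) big_ord_recl e1; congr (_ * (_ + _)).
  under eq_bigr do rewrite eS.
  by rewrite sumr_const card_ord mulr_natl.
Qed.

(** The Rayleigh quotient of [C] at [x]. *)
Definition along C x := qform C x / qform 1%:M x.

Definition info_matrix C := psd C /\ C *m const_mx 1 = 0 :> 'cV_t.

Lemma along_ge0 C x : info_matrix C -> 0 <= along C x.
Proof.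
move=> [[_ h] _]; rewrite divr_ge0 ?h // qform1E sumr_ge0 // => i _.
exact: sqr_ge0.
Qed.

Lemma along_le_trace C x : info_matrix C -> contrast x -> along C x <= \tr C.
Proof.
by move=> [Cp _] [_ x0]; rewrite ler_pdivrMr ?qform1_gt0 // psd_le_trace.
Qed.

Lemma Phi_ge0 c C x : info_matrix C -> contrast x -> 0 <= Phi c C.
Proof.
move=> [Cp C1] [x1 x0]; have [e0 _ _ _] := eig_data Cp C1 x1 x0.
case: c => //=.
- case: eqP => // _; rewrite divr_ge0 // sumr_ge0 // => i _.
  by rewrite invr_ge0.
- exact: powR_ge0.
- by rewrite mulr_ge0 ?invr_ge0 // sumr_ge0.
Qed.

Lemma Phi_critT C x : info_matrix C -> contrast x ->
  Phi critT C = n.+1%:R^-1 * \tr C.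
Proof.
by move=> [Cp C1] [x1 x0]; have [_ _ <- _] := eig_data Cp C1 x1 x0.
Qed.

Lemma Phi_singular c C : c <> critT -> eig C 1 = 0 -> Phi c C = 0.
Proof.
case: c => //= _ e1; first by rewrite e1 eqxx.
(* The exponent has to be nonzero here, since [powR 0 0] is 1. *)
rewrite big_ltn // e1 mul0r powR0 // invr_eq0 pnatr_eq0 //.
Qed.

(** If [eig C 1] were positive, [along C x] would be a weighted mean of eigenvalues that are at
    least [eig C 1]. *)
Lemma Phi_along0 c C x : c <> critT -> info_matrix C -> contrast x ->
  along C x = 0 -> Phi c C = 0.
Proof.
move=> cT [Cp C1] [x1 x0]; have [e0 em _ h] := eig_data Cp C1 x1 x0.
rewrite /along => p0; case: h => [/(Phi_singular cT)//|[s [s0 s1 sp]]].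
apply: Phi_singular => //; apply: le_anti; rewrite e0 andbT.
rewrite p0 in sp; rewrite -sp -[X in X <= _]mul1r -s1 mulr_suml.
rewrite big_nat [X in _ <= X]big_nat; apply: ler_sum => i it.
by rewrite ler_wpM2l // em.
Qed.

(** For the A-, D- and T-criteria, [al] and [be] are the partial derivatives in a single eigenvalue
    at the spectrum [a, b, ..., b]; equality at that spectrum is Euler's identity for a function
    homogeneous of degree one. For the E-criterion they are 1 and 0. *)
Lemma Phi_support c a b : 0 < a -> a <= b ->
  exists al be : R, [/\ 0 <= al, 0 <= be,
    al * a + be * (n%:R * b) = phi2 c a b &
    forall C x, info_matrix C -> contrast x ->
      Phi c C <= al * along C x + be * (\tr C - along C x)].
Proof.
move=> a0 ab; have b0 := lt_le_trans a0 ab.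
have n0 : 0 <= n%:R :> R by [].
have m0 : 0 < n.+1%:R :> R by [].
have mE : n.+1%:R = n%:R + 1 :> R by rewrite -natr1.
(* When [eig C 1 = 0], every criterion but T vanishes and the majorant is nonnegative, so this case
   is set aside. *)
suff [al [be [al0 be0 h1 h2]]] : exists al be : R, [/\ 0 <= al, 0 <= be,
    al * a + be * (n%:R * b) = phi2 c a b &
    forall C x, info_matrix C -> contrast x -> 0 < eig C 1 \/ c = critT ->
      Phi c C <= al * along C x + be * (\tr C - along C x)].
  exists al, be; split=> // C x hC hx.
  have [cT|cT] : c = critT \/ c <> critT by case: (c); [right|right|right|left].
    by apply: h2 => //; right.
  have [e1|e1] := eqVneq (eig C 1) 0.
    rewrite (Phi_singular cT e1) addr_ge0 // mulr_ge0 ?along_ge0 //.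
    by rewrite subr_ge0 along_le_trace.
  apply: h2 => //; left; rewrite lt_def e1.
  by case: hC hx => [Cp C1] [x1 x0]; have [-> _ _ _] := eig_data Cp C1 x1 x0.
(* The Rayleigh quotient weighs the eigenvalues by [s i], hence the rest of the trace weighs them by
   [1 - s i]. *)
have data C x : info_matrix C -> contrast x -> 0 < eig C 1 ->
    exists s : 'I_n.+1 -> R, [/\ forall i : 'I_n.+1, 0 < eig C i.+1, forall i, 0 <= s i,
      \sum_i s i = 1, eig C 1 <= along C x &
      forall u v, u * along C x + v * (\tr C - along C x) =
        \sum_(i < n.+1) eig C i.+1 * (s i * u + (1 - s i) * v)].
  move=> [Cp C1] [x1 x0] e1.
  have [e0 em <- h] := eig_data Cp C1 x1 x0.
  case: h => [/eqP|[s [s0 s1 sp]]]; first by rewrite gt_eqF.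
  rewrite !big_add1 /= !big_mkord in s1 sp *.
  exists (fun i => s i.+1); split=> // [i||u v].
  - by apply: lt_le_trans e1 _; apply: em; rewrite /= ltnS ltn_ord.
  - rewrite /along -sp -[X in X <= _]mul1r -s1 mulr_suml.
    by apply: ler_sum => i _; rewrite ler_wpM2l // em //= ltnS ltn_ord.
  - rewrite /along -sp mulrBr !mulr_sumr -sumrB -big_split /=.
    by apply: eq_bigr => i _; ring.
have cardE : #|'I_n.+1|%:R - 1 = n%:R :> R by rewrite card_ord mE addrK.
case: c => /=.
- rewrite gt_eqF //; set D := a^-1 + n%:R * b^-1.
  have D0 : 0 < D by rewrite ltr_pwDl ?invr_gt0 // mulr_ge0 // invr_ge0 ltW.
  pose K : R := n.+1%:R / D ^+ 2.
  have K0 : 0 <= K by rewrite divr_ge0 // exprn_ge0 // ltW.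
  exists (K * a^-1 ^+ 2), (K * b^-1 ^+ 2); split.
  + by rewrite mulr_ge0 // exprn_ge0 // invr_ge0 ltW.
  + by rewrite mulr_ge0 // exprn_ge0 // invr_ge0 ltW.
  + transitivity (K * D); first by rewrite /D; field; rewrite !gt_eqF.
    by rewrite /K; field; rewrite gt_eqF.
  + move=> C x hC hx [e1|//]; have [s [ep s0 s1 _ sE]] := data C x hC hx e1.
    rewrite gt_eqF // -(mulrA K) -(mulrA K (b^-1 ^+ 2)) -mulrDr sE.
    rewrite (sum_eig _ (fun z => z^-1)).
    have := harmonic_support a b ep s0 s1; rewrite cardE -/D.
    have h0 : 0 < \sum_(i < n.+1) (eig C i.+1)^-1.
      rewrite big_ord_recl ltr_pwDl ?invr_gt0 // sumr_ge0 // => i _.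
      by rewrite invr_ge0 ltW.
    move=> /(ler_wpM2l K0); apply: le_trans.
    by rewrite mulrA /K mulfVK // gt_eqF // exprn_gt0.
- set K := powR _ _; have K0 : 0 <= K by apply: powR_ge0.
  exists (K * (n.+1%:R^-1 * a^-1)), (K * (n.+1%:R^-1 * b^-1)); split.
  + by rewrite mulr_ge0 // mulr_ge0 ?invr_ge0 ?(ltW a0) ?(ltW b0) ?ler0n.
  + by rewrite mulr_ge0 // mulr_ge0 ?invr_ge0 ?(ltW a0) ?(ltW b0) ?ler0n.
  + by rewrite mE; field; rewrite !gt_eqF // -mE.
  + move=> C x hC hx [e1|//]; have [s [ep s0 s1 _ sE]] := data C x hC hx e1.
    rewrite -!mulrA -!mulrDr sE big_add1 /= big_mkord.
    by have := geometric_support a0 b0 ep s0 s1; rewrite card_ord.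
- exists 1, 0; split=> //; first by rewrite mul1r mul0r addr0.
  move=> C x hC hx [e1|//]; have [s [_ _ _ ea _]] := data C x hC hx e1.
  by rewrite mul1r mul0r addr0.
- exists n.+1%:R^-1, n.+1%:R^-1; split; rewrite ?invr_ge0 //.
    by rewrite mulrDr.
  move=> C x hC hx _; have /= -> := Phi_critT hC hx.
  by rewrite -mulrDr [along _ _ + _]addrC subrK.
Qed.

(* If [a = 0], every [along (C i) (x i)] vanishes, so every [C i] is singular on
   the contrasts. *)
Lemma sum_Phi_le c a b (I : finType) (C : I -> 'M[R]_t) (x : I -> 'cV[R]_t) :
  0 <= a -> a <= b -> (forall i, info_matrix (C i)) -> (forall i, contrast (x i)) ->
  \sum_i along (C i) (x i) <= #|I|%:R * a ->
  \sum_i (\tr (C i) - along (C i) (x i)) <= #|I|%:R * (n%:R * b) ->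
  \sum_i Phi c (C i) <= #|I|%:R * phi2 c a b.
Proof.
move=> a0 ab hC hx ha hb.
have [cT|cT] : c = critT \/ c <> critT by case: (c); [right|right|right|left].
  rewrite cT; rewrite (eq_bigr _ (fun i _ => Phi_critT (hC i) (hx i))).
  rewrite -mulr_sumr /= [leRHS]mulrCA ler_wpM2l ?invr_ge0 // mulrDr.
  apply: le_trans (lerD ha hb); rewrite -big_split /=.
  by apply: ler_sum => i _; rewrite addrC subrK.
have [az|an] := eqVneq a 0.
  have phi0 : phi2 c a b = 0.
    case: (c) cT => //= _; rewrite az ?eqxx //.
    by rewrite mul0r powR0 // invr_eq0 pnatr_eq0.
  rewrite phi0 mulr0 big1 // => i _; apply: (Phi_along0 cT (hC i) (hx i)).
  rewrite az mulr0 in ha; apply: le_anti; rewrite along_ge0 // andbT.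
  apply: le_trans ha; rewrite (bigD1 i) //= lerDl sumr_ge0 // => j _.
  exact: along_ge0.
have ap : 0 < a by rewrite lt_def an.
have [al [be [al0 be0 <- hs]]] := Phi_support c ap ab.
have h : \sum_i Phi c (C i) <= 
    al * \sum_i along (C i) (x i) + be * \sum_i (\tr (C i) - along (C i) (x i)).
  by rewrite !mulr_sumr -big_split /=; apply: ler_sum => i _; apply: hs.
apply: le_trans h _; rewrite mulrDr (mulrCA _ al) (mulrCA _ be).
by apply: lerD; rewrite ler_wpM2l.
Qed.

End Criteria.

(** * Moore-Penrose inverses and orthogonal projections *)

Section MoorePenrose.
Variable R : realType.

Lemma row_free_gram m n (C : 'M[R]_(m, n)) : row_free C -> C *m C^T \in unitmx.
Proof.
move=> Cf; rewrite unitmxE unitfE; apply/det0P => -[v v0 h].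
suff vC : (v *m C)^T = 0.
  case/eqP: v0; apply: (row_free_inj Cf); rewrite mul0mx.
  by rewrite -[LHS]trmxK vC trmx0.
apply/eqP; apply: contraT => /qform1_gt0.
by rewrite /qform mulmx1 trmxK trmx_mul mulmxA -(mulmxA v) h mul0mx mxE ltxx.
Qed.

(** A rank factorisation [A = B *m C] has invertible Gram matrices, and the inverse is given
    explicitly by [X] below. *)
Lemma penrose_exists m n (A : 'M[R]_(m, n)) : exists X, penrose A X.
Proof.
have [r [B [C [-> Bu Cu]]]] : exists r (B : 'M[R]_(m, r)) (C : 'M[R]_(r, n)),
    [/\ A = B *m C, B^T *m B \in unitmx & C *m C^T \in unitmx].
  exists (\rank A), (col_base A), (row_base A); split.
  - by rewrite mulmx_base.
  - rewrite -{2}[col_base A]trmxK; apply: row_free_gram.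
    by rewrite /row_free mxrank_tr; have := col_base_full A; rewrite /row_full.
  - by apply: row_free_gram; apply: row_base_free.
have Ci : invmx (C *m C^T) *m (C *m C^T) = 1%:M by rewrite mulVmx.
have Ci' : (C *m C^T) *m invmx (C *m C^T) = 1%:M by rewrite mulmxV.
have Bi : invmx (B^T *m B) *m (B^T *m B) = 1%:M by rewrite mulVmx.
have Cs : (invmx (C *m C^T))^T = invmx (C *m C^T).
  by rewrite trmx_inv trmx_mul trmxK.
have Bs : (invmx (B^T *m B))^T = invmx (B^T *m B).
  by rewrite trmx_inv trmx_mul trmxK.
pose X := C^T *m invmx (C *m C^T) *m invmx (B^T *m B) *m B^T.
have AX : B *m C *m X = B *m invmx (B^T *m B) *m B^T.
  by rewrite /X !mulmxA -(mulmxA B C) -(mulmxA B (C *m _)) Ci' mulmx1.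
have XA : X *m (B *m C) = C^T *m invmx (C *m C^T) *m C.
  by rewrite /X !mulmxA -(mulmxA _ B^T B) -(mulmxA _ _ (B^T *m B)) Bi mulmx1.
exists X; split.
- by rewrite AX !mulmxA -(mulmxA _ B^T B) -(mulmxA _ _ (B^T *m B)) Bi mulmx1.
- by rewrite XA {1}/X !mulmxA -(mulmxA _ C C^T) -(mulmxA _ _ (C *m C^T)) Ci mulmx1.
- by rewrite AX !trmx_mul trmxK Bs mulmxA.
- by rewrite XA !trmx_mul trmxK Cs mulmxA.
Qed.

Lemma mpinvP m n (A : 'M[R]_(m, n)) : penrose A (mpinv A).
Proof. exact: ClassicalEpsilon.epsilon_spec (penrose_exists A). Qed.

Lemma gram_eq0 m n (D : 'M[R]_(m, n)) : D^T *m D = 0 -> D = 0.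
Proof.
move=> h; apply/matrixP => i j; rewrite mxE.
have /matrixP /(_ j j) := h; rewrite !mxE => /eqP.
rewrite psumr_eq0; last by move=> r _; rewrite mxE -expr2 sqr_ge0.
by move=> /allP /(_ i (mem_index_enum _)); rewrite mxE -expr2 sqrf_eq0 => /eqP.
Qed.

(* [pr Z = Z] gives [pr = pr pr^T], so [pr] is symmetric and idempotent. *)
Lemma gram_projection m n (Z : 'M[R]_(m, n)) (pr := Z *m mpinv (Z^T *m Z) *m Z^T) :
  [/\ pr^T = pr, pr *m pr = pr & pr *m Z = Z].
Proof.
have [h1 _ _ _] := mpinvP (Z^T *m Z); set X := mpinv _ in h1 pr *.
have prZ : pr *m Z = Z.
  (* The Gram matrix of [pr *m Z - Z] contains the factor [Z^T *m Z *m (X *m (Z^T *m Z) - 1%:M)],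
     which is 0 by the first Penrose equation. *)
  apply/eqP; rewrite -subr_eq0; apply/eqP/gram_eq0.
  have -> : pr *m Z - Z = Z *m (X *m (Z^T *m Z) - 1%:M).
    by rewrite mulmxBr mulmx1 /pr !mulmxA.
  rewrite trmx_mul -!mulmxA (mulmxA Z^T Z) mulmxBr mulmx1 (mulmxA (Z^T *m Z)).
  by rewrite h1 subrr mulmx0.
have prE : pr = pr *m pr^T.
  have -> : pr *m pr^T = Z *m X *m (pr *m Z)^T by rewrite [(pr *m Z)^T]trmx_mul {1}/pr !mulmxA.
  by rewrite prZ.
have prs : pr^T = pr by rewrite {1}prE trmx_mul trmxK -prE.
by split=> //; rewrite [RHS]prE prs.
Qed.

Lemma qform_gram m n (E : 'M[R]_(m, n)) v : qform (E^T *m E) v = qform 1%:M (E *m v).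
Proof. by rewrite /qform mulmx1 trmx_mul !mulmxA. Qed.

Lemma qform1_ge0 n (v : 'cV[R]_n) : 0 <= qform 1%:M v.
Proof. by rewrite qform1E sumr_ge0 // => i _; apply: sqr_ge0. Qed.

Lemma gram_psd m n (E : 'M[R]_(m, n)) : psd (E^T *m E).
Proof.
by split=> [|v]; [rewrite trmx_mul trmxK|rewrite qform_gram qform1_ge0].
Qed.
End MoorePenrose.

(** * Information matrices as Gram matrices of least-squares residuals *)

Section Information.
Variables (R : realType) (k n : nat) (S : 'M[R]_k).
Local Notation t := n.+2.
Variable xi : measure_on R k t.
Implicit Types (u v : 'cV[R]_3) (x : 'cV[R]_t).

(** Supplied by [gram_Cxi] for nonnegative [xi] when [Btilde S] is [mean_proj]. *)
Hypothesis gram : exists N (A : 'I_3 -> 'M[R]_(N, t)),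
  (forall i, A i *m const_mx 1 = 0 :> 'cV_N) /\
  (forall i j, Cxi S xi i j = (A i)^T *m A j).

Lemma Cuw_gram : exists N (A : 'cV[R]_3 -> 'M[R]_(N, t)),
  [/\ forall u, A u *m const_mx 1 = 0 :> 'cV_N,
      forall u v, Cuw S xi u v = (A u)^T *m A v,
      forall u v, A (u + v) = A u + A v & forall a u, A (a *: u) = a *: A u].
Proof.
have [N [A [A1 AE]]] := gram.
exists N, (fun u => \sum_i u i 0 *: A i); split.
- move=> u; rewrite mulmx_suml big1 // => i _.
  by rewrite -scalemxAl A1 scaler0.
- move=> u v; have -> : (\sum_i u i 0 *: A i)^T = \sum_i u i 0 *: (A i)^T.
    by rewrite raddf_sum; apply: eq_bigr => i _; apply/matrixP => a b; rewrite !mxE.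
  rewrite /Cuw mulmx_suml; apply: eq_bigr => i _.
  rewrite mulmx_sumr; apply: eq_bigr => j _.
  by rewrite -scalemxAl -scalemxAr scalerA AE.
- by move=> u v; rewrite -big_split; apply: eq_bigr => i _; rewrite mxE scalerDl.
- by move=> a u; rewrite scaler_sumr; apply: eq_bigr => i _; rewrite mxE scalerA.
Qed.

Lemma Cuw_psd u : info_matrix (Cuw S xi u u).
Proof.
have [N [A [A1 AE _ _]]] := Cuw_gram; rewrite AE; split; first exact: gram_psd.
by rewrite -mulmxA A1 mulmx0.
Qed.

Definition affine_shift m u (w : 'I_m -> 'cV[R]_3) (be : 'I_m -> R) :=
  u + \sum_a be a *: w a.

(** Let the columns of [Z] be the vectors [A (w a) *m x]. Then [F = Z^T *m A u] and [G = Z^T *m Z],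
    so [I] is the Gram matrix of [(1 - pr) *m A u], where [pr] projects orthogonally onto the column
    space of [Z]. Its quadratic form at [x] is the squared distance from [A u *m x] to that space, a
    least-squares minimum. *)
Lemma Iinfo_spec m u (w : 'I_m -> 'cV[R]_3) x (I := Iinfo S xi u w x) :
  [/\ info_matrix I, psd (Cuw S xi u u - I),
      exists be, qform I x = qform (Cuw S xi (affine_shift u w be) (affine_shift u w be)) x &
      forall be, qform I x <= qform (Cuw S xi (affine_shift u w be) (affine_shift u w be)) x].
Proof.
have [N [A [A1 AE AD AZ]]] := Cuw_gram.
pose Z := \matrix_(r, a) (A (w a) *m x) r 0.
have [ps pp pZ] := gram_projection Z; set pr := _ *m Z^T in ps pp pZ.
have IE : I = (A u)^T *m (1%:M - pr) *m A u.
  rewrite mulmxBr mulmxBl mulmx1 /I /Iinfo AE; congr (_ - _).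
  set F := \matrix_(a, l) _; set G := \matrix_(a, b) _.
  have -> : F = Z^T *m A u.
    apply/matrixP => a l; rewrite [LHS]mxE [RHS]mxE AE -mulmxA [LHS]mxE.
    by apply: eq_bigr => r _; rewrite [Z^T _ _]mxE [Z _ _]mxE [(A u)^T _ _]mxE mulrC.
  have -> : G = Z^T *m Z.
    apply/matrixP => a b; rewrite [LHS]mxE [RHS]mxE AE !mulmxA -trmx_mul -mulmxA.
    by rewrite [LHS]mxE; apply: eq_bigr => r _; rewrite [Z^T _ _]mxE ![Z _ _]mxE
      [(_)^T _ _]mxE.
  by rewrite trmx_mul trmxK /pr !mulmxA.
pose E := (1%:M - pr) *m A u.
have Ex : E *m x = (1%:M - pr) *m (A u *m x) by rewrite /E mulmxA.
have q2 : (1%:M - pr) *m (1%:M - pr) = 1%:M - pr.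
  by rewrite mulmxBl mul1mx mulmxBr mulmx1 pp subrr subr0.
have qs : (1%:M - pr)^T = 1%:M - pr by rewrite raddfB /= trmx1 ps.
have IE' : I = E^T *m E.
  by rewrite IE /E trmx_mul qs -{1}q2 !mulmxA.
have shiftE be : A (affine_shift u w be) *m x = A u *m x + Z *m \col_a be a.
  have sumA (s : seq 'I_m) : A (\sum_(a <- s) be a *: w a) = \sum_(a <- s) be a *: A (w a).
    elim: s => [|a s IH]; last by rewrite !big_cons AD AZ IH.
    by rewrite !big_nil -(scale0r 0) AZ scale0r.
  rewrite /affine_shift AD mulmxDl sumA mulmx_suml; congr (_ + _).
  apply/colP => r; rewrite summxE mxE; apply: eq_bigr => a _.
  by rewrite -scalemxAl !mxE mulrC.
have split_norm (y : 'cV[R]_N) :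
    qform 1%:M y = qform 1%:M ((1%:M - pr) *m y) + qform 1%:M (pr *m y).
  by rewrite -!qform_gram qs ps q2 pp -qformD subrK.
split.
- split; first by rewrite IE'; apply: gram_psd.
  by rewrite IE -mulmxA A1 mulmx0.
- rewrite AE IE mulmxBr mulmxBl mulmx1 opprB addrCA subrr addr0.
  have -> : (A u)^T *m pr *m A u = (pr *m A u)^T *m (pr *m A u).
    by rewrite trmx_mul ps mulmxA -(mulmxA _ pr pr) pp.
  exact: gram_psd.
(* These are the least-squares coefficients: the shift subtracts the projection of [A u *m x]. *)
- exists (fun a => - (mpinv (Z^T *m Z) *m Z^T *m (A u *m x)) a 0).
  rewrite AE IE' !qform_gram shiftE; congr qform.
  rewrite Ex mulmxBl mul1mx; congr (_ + _).
  rewrite (_ : \col_a _ = - (mpinv (Z^T *m Z) *m Z^T *m (A u *m x))).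
    by rewrite mulmxN /pr !mulmxA.
  by apply/colP => a; rewrite !mxE.
(* By Pythagoras, a shift inside the column space of [Z] leaves the residual unchanged and only adds
   a squared norm. *)
- move=> be; rewrite AE IE' !qform_gram shiftE.
  have pZ0 : (1%:M - pr) *m Z = 0 by rewrite mulmxBl mul1mx pZ subrr.
  rewrite [leRHS]split_norm [(1%:M - pr) *m (_ + _)]mulmxDr.
  rewrite [_ *m (Z *m _)]mulmxA pZ0 mul0mx addr0 Ex.
  by rewrite lerDl qform1_ge0.
Qed.

Definition qval v : R := \tr (Cuw S xi v v) / n.+1%:R.

Lemma centering_contrast x : contrast x -> centering R n *m x = x.
Proof.
move=> [x1 _]; rewrite mulmxBl mul1mx -scalemxAl (_ : const_mx 1 *m x = 0) ?scaler0 ?subr0 //.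
apply/row_matrixP => i; rewrite row_mul row0 (_ : row i _ = const_mx 1) ?x1 //.
by apply/matrixP => a b; rewrite !mxE.
Qed.

(** Killing the ones vector forces [a + t b = 0], which leaves [a] times [centering], a projection
    of trace [t - 1]. *)
Lemma completely_symmetric_kernel (C : 'M[R]_t) : completely_symmetric C ->
  C *m const_mx 1 = 0 :> 'cV_t -> C = (\tr C / n.+1%:R) *: centering R n.
Proof.
move=> [a [b CE]] C1.
have h : a + t%:R * b = 0.
  have /colP/(_ 0) := C1; rewrite CE mulmxDl -!scalemxAl mul1mx !mxE mulr1.
  rewrite (eq_bigr (fun=> 1)) => [|i _]; last by rewrite !mxE mulr1.
  by rewrite sumr_const card_ord mulrC.
have trE : \tr C = n.+1%:R * a.
  rewrite CE mxtraceD !mxtraceZ mxtrace1 [X in b * X](_ : _ = t%:R).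
    rewrite mulrC [b * _]mulrC (_ : t%:R * b = - a); last by lra.
    by rewrite -[t%:R]natr1; ring.
  rewrite /mxtrace (eq_bigr (fun=> 1)) => [|i _]; last by rewrite !mxE.
  by rewrite sumr_const card_ord.
have bE : b = - (t%:R^-1 * a).
  apply: (mulfI (_ : t%:R != 0)); first by rewrite pnatr_eq0.
  by rewrite mulrN mulrA mulfV ?pnatr_eq0 // mul1r; lra.
rewrite trE mulrC mulKf ?pnatr_eq0 // /centering scalerBr scalerA CE bE.
by rewrite scaleNr [a * _]mulrC.
Qed.

Lemma Cuw_pseudo : pseudo_symmetric S xi -> forall u v,
  Cuw S xi u v = (\tr (Cuw S xi u v) / n.+1%:R) *: centering R n.
Proof.
move=> ps u v; have [N [A [A1 AE]]] := gram.
have CE i j : Cxi S xi i j = (\tr (Cxi S xi i j) / n.+1%:R) *: centering R n.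
  apply: completely_symmetric_kernel; first exact: ps.
  by rewrite AE -mulmxA A1 mulmx0.
rewrite /Cuw raddf_sum mulr_suml scaler_suml; apply: eq_bigr => i _.
rewrite raddf_sum mulr_suml scaler_suml; apply: eq_bigr => j _.
by rewrite /= mxtraceZ {1}CE scalerA mulrA.
Qed.

Lemma qform_pseudo : pseudo_symmetric S xi -> forall v x, contrast x ->
  qform (Cuw S xi v v) x = qval v * qform 1%:M x.
Proof.
move=> ps v x hx; rewrite (Cuw_pseudo ps) /qform -mulmxA -scalemxAl.
by rewrite (centering_contrast hx) -scalemxAr mxE mulmx1.
Qed.

(** Each [C_xi[u, w a]] is a multiple of [centering] and maps [x] to a multiple of [x]. So the
    subtracted term is a multiple of [x *m x^T], and the Rayleigh quotient at [x] identifies the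
    multiple. *)
Lemma Iinfo_two_level m u (w : 'I_m -> 'cV[R]_3) x :
  pseudo_symmetric S xi -> contrast x ->
  Iinfo S xi u w x = two_level (along (Iinfo S xi u w x) x) (qval u) x.
Proof.
move=> ps hx; have x0 : qform 1%:M x != 0 by rewrite gt_eqF // qform1_gt0 //; case: hx.
have xx : x^T *m x = (qform 1%:M x)%:M.
  by rewrite [LHS]mx11_scalar /qform mulmx1.
have [ka IE] : exists ka, Iinfo S xi u w x = qval u *: centering R n - ka *: (x *m x^T).
  rewrite /Iinfo; set F := \matrix_(a, l) _; set G := \matrix_(a, b) _.
  pose y := \col_a (\tr (Cuw S xi u (w a)) / n.+1%:R).
  have -> : F = y *m x^T.
    apply/matrixP => a l; rewrite [LHS]mxE [RHS]mxE big_ord1 (Cuw_pseudo ps) -scalemxAl.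
    by rewrite (centering_contrast hx) [LHS]mxE [y _ _]mxE [x^T _ _]mxE.
  have yE := mx11_scalar (y^T *m mpinv G *m y).
  exists ((y^T *m mpinv G *m y) 0 0); rewrite (Cuw_pseudo ps); congr (_ - _).
  rewrite trmx_mul trmxK !mulmxA -(mulmxA x) -(mulmxA x); move: yE; set c := _ 0 0 => ->.
  by rewrite mul_mx_scalar -scalemxAl.
have qE : qform (Iinfo S xi u w x) x = qval u * qform 1%:M x - ka * qform 1%:M x ^+ 2.
  rewrite IE -scaleNr qformD; congr (_ + _).
    rewrite /qform -mulmxA -scalemxAl (centering_contrast hx) -scalemxAr mulmx1.
    by rewrite mxE.
  move: (qform 1%:M x) xx => X xx.
  rewrite /qform -scalemxAr -scalemxAl !mulmxA xx mul_scalar_mx -scalemxAl xx.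
  by rewrite !mxE /= !mulr1n; ring.
rewrite {1}IE /two_level /along qE; congr (_ - _ *: _); field.
by rewrite x0.
Qed.
End Information.

(** * Integration against an exchangeable distribution *)

Section Exchangeable.
Variables (R : realType) (t : nat).
Variable g : probability (t.-tuple R) R.
Local Open Scope classical_set_scope.
Import HBNNSimple.

Lemma measurable_permute (sg : 'S_t) :
  measurable_fun [set: t.-tuple R] (@permute_tuple R t sg).
Proof.
apply/measurable_fun_tnthP => i.
rewrite (_ : _ \o _ = (@tnth t R) ^~ (sg i)); first exact: measurable_tnth.
by apply/funext => x /=; rewrite tnth_mktuple.
Qed.

Lemma measurable_Tset : measurable (@Tset R t).
Proof.
have -> : @Tset R t =
   ((fun x : t.-tuple R => \sum_i tnth x i) @^-1` [set 0]) `&`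
   \bigcup_(i in [set: 'I_t]) ((fun x : t.-tuple R => tnth x i) @^-1` (~` [set 0])).
  apply/seteqP; split => [x /andP[/eqP h /existsP[i /eqP hi]]|x [/= h [i _ hi]]].
    by split => //; exists i.
  by rewrite /Tset /= h eqxx; apply/existsP; exists i; apply/eqP.
apply: measurableI.
  rewrite -[X in measurable X]setTI.
  have := @measurable_sum _ _ R [set: t.-tuple R] _ (index_enum 'I_t)
    (fun i x => tnth x i) (fun i => @measurable_tnth _ R t i).
  by move=> /(_ measurableT [set 0]); apply; exact: measurable_set1.
apply: fin_bigcup_measurable => [|i _]; first exact: finite_finset.
rewrite -[X in measurable X]setTI; apply: measurable_tnth => //.
by apply: measurableC; exact: measurable_set1.
Qed.

Lemma Tset_permute (sg : 'S_t) x : @Tset R t (permute_tuple sg x) <-> @Tset R t x.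
Proof.
rewrite /Tset /=.
have -> : \sum_i tnth (permute_tuple sg x) i = \sum_i tnth x i.
  rewrite [RHS](reindex_inj (@perm_inj _ sg)).
  by apply: eq_bigr => i _; rewrite tnth_mktuple.
suff -> : [exists i, tnth (permute_tuple sg x) i != 0] = [exists i, tnth x i != 0] by [].
apply/existsP/existsP => -[i hi].
  by exists (sg i); rewrite tnth_mktuple in hi.
by exists ((sg^-1)%g i); rewrite tnth_mktuple permKV.
Qed.

Hypothesis hex : exchangeable g.

Lemma integral_permute (sg : 'S_t) (h : {nnsfun (t.-tuple R) >-> R}) :
  (\int[g]_x (h (permute_tuple sg x))%:E = \int[g]_x (h x)%:E)%E.
Proof.
have mh : measurable_fun [set: t.-tuple R] (EFin \o (h : t.-tuple R -> R)).
  by apply/measurable_EFinP.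
have := @ge0_integral_pushforward _ _ _ _ R (permute_tuple sg)
  (measurable_permute sg) g setT (EFin \o (h : t.-tuple R -> R))
  measurableT mh.
rewrite preimage_setT /= => <-; last by move=> y _; rewrite lee_fin.
apply: eq_measure_integral; first exact: measurable_permute.
by move=> ? A mA _; exact: hex.
Qed.

(* The integral of a nonnegative function is a supremum over the simple functions
   below it; those, unlike [f], are measurable and can be averaged over the
   permutations. *)
Lemma integral_le_of_average (f : t.-tuple R -> R) (K : R) : 0 <= K ->
  (forall x, @Tset R t x -> 0 <= f x) ->
  (forall x, @Tset R t x -> \sum_(sg : 'S_t) f (permute_tuple sg x) <= #|'S_t|%:R * K) ->
  (\int[g]_(x in @Tset R t) (f x)%:E <= K%:E)%E.
Proof.
move=> K0 f0 fK.
rewrite ge0_integralE; last by move=> x Tx; rewrite lee_fin f0.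
apply: ge_ereal_sup => _ [h /= hf] <-.
have hle x : @Tset R t x -> h x <= f x.
  by move=> Tx; have := hf x; rewrite patchE mem_set // lee_fin.
(* The integrand is extended by 0 outside [Tset]. *)
have hN x : ~ @Tset R t x -> h x <= 0.
  by move=> Tx; have := hf x; rewrite patchE memNset // lee_fin.
have N0 : 0 < #|'S_t|%:R :> R by rewrite ltr0n; apply/card_gt0P; exists 1%g.
have -> : sintegral g h = (\int[g]_x (h x)%:E)%E.
  by rewrite integral_nnsfun // patch_setT.
(* All permuted copies of [h] have the same integral, so the pointwise bound on their sum bounds the
   integral of [h]. *)
have avg : ((#|'S_t|%:R)%:E * \int[g]_x (h x)%:E <= (#|'S_t|%:R)%:E * K%:E)%E.
  have <- : (\sum_(sg : 'S_t) \int[g]_x (h (permute_tuple sg x))%:E =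
             (#|'S_t|%:R)%:E * \int[g]_x (h x)%:E)%E.
    under eq_bigr do rewrite integral_permute.
    by rewrite sumr_const mule_natl.
  have mh sg : measurable_fun [set: t.-tuple R]
      (fun x => (h (permute_tuple sg x))%:E).
    apply/measurable_EFinP; apply: (measurableT_comp _ (measurable_permute sg)).
    exact: measurable_funP.
  rewrite -ge0_integral_sum //; last by move=> sg x _; rewrite lee_fin.
  apply: (@le_trans _ _ (\int[g]_x ((#|'S_t|%:R * K)%:E))%E).
    apply: ge0_le_integral => //.
    - by move=> x _; apply: sume_ge0 => sg _; rewrite lee_fin.
    - exact: emeasurable_sum.
    - move=> x _; rewrite sumEFin lee_fin.
      have [Tx|Tx] := pselect (@Tset R t x).
        apply: le_trans (fK _ Tx); apply: ler_sum => sg _; apply: hle.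
        by rewrite Tset_permute.
      apply: (@le_trans _ _ 0); last by rewrite mulr_ge0.
      by apply: sumr_le0 => sg _; apply: hN; rewrite Tset_permute.
  rewrite integral_cst // [X in (_ * X)%E](_ : _ = 1%E) ?mule1 ?EFinM //.
  exact: probability_setT.
by move: avg; rewrite lee_pmul2l // lte_fin.
Qed.

End Exchangeable.

(** * The matrix [Btilde] for type-H covariance *)

Section TypeH.
Variables (R : realType) (k : nat).
Hypothesis k0 : (0 < k)%N.

Definition mean_proj : 'M[R]_k := 1%:M - (k%:R)^-1 *: const_mx 1.

Lemma mean_proj_sym : mean_proj^T = mean_proj.
Proof. by apply/matrixP => i j; rewrite !mxE eq_sym. Qed.

Lemma mean_proj_ones : mean_proj *m ones R k = 0.
Proof.
apply/colP => i; rewrite mulmxBl mul1mx -scalemxAl !mxE.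
rewrite (eq_bigr (fun=> 1)) => [|j _]; last by rewrite !mxE mulr1.
by rewrite sumr_const card_ord mulVf ?subrr // pnatr_eq0 -lt0n.
Qed.

Lemma ones_mean_proj : (ones R k)^T *m mean_proj = 0.
Proof. by rewrite -mean_proj_sym -trmx_mul mean_proj_ones trmx0. Qed.

Lemma mean_projE : mean_proj = 1%:M - (k%:R)^-1 *: (ones R k *m (ones R k)^T).
Proof.
congr (_ - _ *: _); apply/matrixP => i j.
by rewrite !mxE big_ord1 !mxE mulr1.
Qed.

Lemma mean_proj_idem : mean_proj *m mean_proj = mean_proj.
Proof.
by rewrite {2}mean_projE mulmxBr mulmx1 -scalemxAr mulmxA mean_proj_ones mul0mx scaler0 subr0.
Qed.

Lemma posdef_unit (S : 'M[R]_k) : posdef S -> S \in unitmx.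
Proof.
move=> [_ pS]; rewrite unitmxE unitfE; apply/det0P => -[v v0 h].
have /pS : v^T != 0 by apply: contra v0 => /eqP h'; rewrite -[v]trmxK h' trmx0.
by rewrite trmxK h mul0mx mxE ltxx.
Qed.

(* Both sides equal [Btilde S *m S *m mean_proj]: [Btilde S] kills the ones vector on
   either side, and the type-H perturbation of [S] is killed by [mean_proj]. *)
Lemma Btilde_typeH (S : 'M[R]_k) : posdef S -> typeH S -> Btilde S = mean_proj.
Proof.
move=> pS [eta SE]; have Su := posdef_unit pS; case: pS => Ssym pS.
have SS : invmx S *m S = 1%:M by rewrite mulVmx.
set one := ones R k; set c := (one^T *m invmx S *m one) 0 0.
have Sis : (invmx S)^T = invmx S by rewrite trmx_inv Ssym.
have one0 : one != 0.
  by apply/eqP => /colP /(_ (Ordinal k0)); rewrite !mxE; apply/eqP; rewrite oner_eq0.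
(* [c] is the quadratic form of [S] at [invmx S *m one]. *)
have c0 : 0 < c.
  have := pS (invmx S *m one); rewrite trmx_mul Sis -!mulmxA (mulmxA S).
  rewrite mulmxV // mul1mx mulmxA.
  apply; apply: contra one0 => /eqP h.
  by rewrite -[one]mul1mx -(mulmxV Su) -mulmxA h mulmx0.
have cE : one^T *m invmx S *m one = c%:M := mx11_scalar _.
have B1 : Btilde S *m one = 0.
  rewrite /Btilde -/one -/c mulmxBl -scalemxAl -!mulmxA (mulmxA one^T) cE.
  by rewrite mul_mx_scalar -scalemxAr scalerA mulVf ?gt_eqF // scale1r subrr.
transitivity (Btilde S *m S *m mean_proj).
  have -> : Btilde S *m S *m mean_proj = Btilde S *m mean_proj.
    move: (Btilde S) B1 => B B1.
    rewrite -mulmxA SE !mulmxDl mul1mx -!mulmxA ones_mean_proj mulmx0 addr0.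
    by rewrite mulmxDr !mulmxA B1 !mul0mx addr0.
  move: (Btilde S) B1 => B B1.
  by rewrite mean_projE mulmxBr mulmx1 -scalemxAr mulmxA B1 mul0mx scaler0 subr0.
rewrite /Btilde -/one -/c mulmxBl SS -scalemxAl -!mulmxA SS mulmx1.
by rewrite mulmxBl mul1mx -scalemxAl -!mulmxA ones_mean_proj !mulmx0 scaler0 subr0.
Qed.
End TypeH.

(** * The cyclic shift and the symmetry between left and right neighbours *)

Section Circulant.
Variables (R : realType) (k n : nat) (S : 'M[R]_k).
Local Notation t := n.+2.
Hypothesis k0 : (0 < k)%N.
Hypothesis SB : Btilde S = mean_proj R k.
Implicit Types (s : seqT k t) (xi : measure_on R k t).

Let p : 'S_k := perm (@ordS_inj k).

Lemma Hmat_perm : Hmat R k = (perm_mx p)^T.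
Proof. by apply/matrixP => i j; rewrite !mxE permE -val_eqE /= eq_sym. Qed.

Lemma Hmat_tr_mul : (Hmat R k)^T *m Hmat R k = 1%:M.
Proof. by rewrite Hmat_perm trmxK tr_perm_mx -perm_mxM mulgV perm_mx1. Qed.

Lemma Hmat_mul_tr : Hmat R k *m (Hmat R k)^T = 1%:M.
Proof. by apply: mulmx1C; exact: Hmat_tr_mul. Qed.

Lemma perm_mx_ones m (q : 'S_m) : perm_mx q *m ones R m = ones R m.
Proof. by rewrite -row_permE; apply/matrixP => i j; rewrite !mxE. Qed.

Lemma Hmat_ones : Hmat R k *m ones R k = ones R k.
Proof. by rewrite Hmat_perm tr_perm_mx perm_mx_ones. Qed.

Lemma HmatT_ones : (Hmat R k)^T *m ones R k = ones R k.
Proof. by rewrite Hmat_perm trmxK perm_mx_ones. Qed.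

(** The shift and its transpose both fix the ones vector. *)
Lemma mean_proj_Hmat : mean_proj R k *m Hmat R k = Hmat R k *m mean_proj R k.
Proof.
rewrite !mean_projE mulmxBl mulmxBr mul1mx mulmx1 -scalemxAl -scalemxAr.
rewrite mulmxA Hmat_ones -mulmxA; congr (_ - _ *: (_ *m _)).
by rewrite -[Hmat R k in LHS]trmxK -trmx_mul HmatT_ones.
Qed.

Lemma mean_proj_HmatT : mean_proj R k *m (Hmat R k)^T = (Hmat R k)^T *m mean_proj R k.
Proof. by rewrite -{1}mean_proj_sym -trmx_mul -mean_proj_Hmat trmx_mul mean_proj_sym. Qed.

Lemma Gmat_ones i s : Gmat R i s *m ones R t = ones R k.
Proof.
have T1 : Tmat R s *m ones R t = ones R k.
  apply/colP => j; rewrite !mxE (bigD1 (s j)) //= !mxE eqxx mulr1 big1 ?addr0 //.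
  by move=> l hl; rewrite !mxE eq_sym (negPf hl) mul0r.
rewrite /Gmat; case: (val i) => [|[|m]] //.
  by rewrite /Lmat -mulmxA T1 Hmat_ones.
by rewrite /Rmat -mulmxA T1 HmatT_ones.
Qed.

(** [mean_proj] is symmetric and idempotent, so the factors stack the rows of
    [mean_proj *m Gmat i s], weighted by [Num.sqrt (xi s)], over all pairs of a sequence and a
    period. Row sums vanish because [Gmat i s] sends the ones vector to the ones vector. *)
Lemma gram_Cxi xi : (forall s, 0 <= xi s) ->
  exists N (A : 'I_3 -> 'M[R]_(N, t)),
  (forall i, A i *m const_mx 1 = 0 :> 'cV_N) /\
  (forall i j, Cxi S xi i j = (A i)^T *m A j).
Proof.
move=> xi0; pose I := (seqT k t * 'I_k)%type.
pose E i (sq : I) l := Num.sqrt (xi sq.1) * (mean_proj R k *m Gmat R i sq.1) sq.2 l.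
exists #|{: I}|, (fun i => \matrix_(r, l) E i (enum_val r) l); split.
  move=> i; apply/colP => r; rewrite [RHS]mxE.
  transitivity (Num.sqrt (xi (enum_val r).1) *
      (mean_proj R k *m (Gmat R i (enum_val r).1 *m ones R t)) (enum_val r).2 0).
    rewrite mulmxA [X in _ = _ * X]mxE [LHS]mxE mulr_sumr; apply: eq_bigr => l _.
    by rewrite ![(const_mx _) _ _]mxE !mulr1 [LHS]mxE.
  by rewrite Gmat_ones mean_proj_ones // mxE mulr0.
move=> i j; apply/matrixP => l l'; rewrite [RHS]mxE.
transitivity (\sum_(sq : I) E i sq l * E j sq l'); last first.
  rewrite (reindex (@enum_val I predT)); last first.
    by apply: onW_bij; exact: enum_val_bij.
  by apply: eq_bigr => r _; rewrite !mxE.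
rewrite /Cxi summxE -(pair_bigA _ (fun s q => E i (s, q) l * E j (s, q) l')) /=.
apply: eq_bigr => s _; rewrite mxE /Cs SB -(mean_proj_idem R k0) -{1}(mean_proj_sym R k).
rewrite mulmxA -trmx_mul -mulmxA [X in _ * X]mxE mulr_sumr; apply: eq_bigr => q _.
rewrite /E /= [_^T _ _]mxE mulrACA -expr2 sqr_sqrtr //.
Qed.

Definition trc xi i j : R := \tr (Cxi S xi i j).

Lemma trcE xi i j : trc xi i j = \sum_s xi s * \tr (Cs S s i j).
Proof. by rewrite /trc /Cxi raddf_sum; apply: eq_bigr => s _; rewrite /= mxtraceZ. Qed.

Lemma trc_sym xi i j : trc xi i j = trc xi j i.
Proof.
rewrite !trcE; apply: eq_bigr => s _; congr (_ * _).
by rewrite -mxtrace_tr /Cs !trmx_mul trmxK SB mean_proj_sym mulmxA.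
Qed.

Let i0 : 'I_3 := 0.
Let i1 : 'I_3 := 1.
Let i2 : 'I_3 := 2.

(** Moving the shift across [mean_proj] turns [T'BHT] into [(H'T)'BT], that is, turns a left
    neighbour on one side into a right neighbour on the other. *)
Lemma trc_cross xi : trc xi i0 i1 = trc xi i0 i2.
Proof.
rewrite [RHS]trc_sym !trcE; apply: eq_bigr => s _; congr (_ * _).
rewrite /Cs SB /Gmat /= /Lmat /Rmat trmx_mul trmxK !mulmxA.
by rewrite -(mulmxA _ (mean_proj R k)) mean_proj_Hmat !mulmxA.
Qed.

(** The shift is orthogonal and commutes with [mean_proj], so both sides reduce to the trace of
    [T'BT]. *)
Lemma trc_diag xi : trc xi i1 i1 = trc xi i2 i2.
Proof.
rewrite !trcE; apply: eq_bigr => s _; congr (_ * _).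
rewrite /Cs SB /Gmat /= /Lmat /Rmat !trmx_mul !trmxK !mulmxA.
rewrite -(mulmxA _ (mean_proj R k)) mean_proj_Hmat -(mulmxA _ (mean_proj R k)) mean_proj_HmatT.
by rewrite !mulmxA -(mulmxA _ _ (Hmat R k)) Hmat_tr_mul -(mulmxA _ (Hmat R k)) Hmat_mul_tr.
Qed.

(** The formula makes the invariance under exchanging [b] and [c] visible. *)
Lemma qval_vec3 xi a b c : qval S xi (vec3 a b c) =
  (trc xi i0 i0 * a ^+ 2 + 2 * trc xi i0 i1 * (a * (b + c)) +
   trc xi i1 i1 * (b ^+ 2 + c ^+ 2) + 2 * trc xi i1 i2 * (b * c)) / n.+1%:R.
Proof.
rewrite /qval; congr (_ / _).
have -> : \tr (Cuw S xi (vec3 a b c) (vec3 a b c)) =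
  \sum_(i < 3) \sum_(j < 3) vec3 a b c i 0 * vec3 a b c j 0 * trc xi i j.
  rewrite /Cuw raddf_sum; apply: eq_bigr => i _.
  by rewrite raddf_sum; apply: eq_bigr => j _; rewrite /= mxtraceZ.
rewrite !big_ord_recl !big_ord0 !mxE /=.
have -> : lift ord0 ord0 = i1 by apply: val_inj.
have -> : lift ord0 (lift ord0 ord0) = i2 by apply: val_inj.
have -> : ord0 = i0 by apply: val_inj.
rewrite (trc_sym xi i1 i0) (trc_sym xi i2 i0) (trc_sym xi i2 i1) -trc_cross -trc_diag.
ring.
Qed.

End Circulant.

(** * Averaging a measure over relabellings of the treatments *)

Section Symmetrization.
Variables (R : realType) (k n : nat) (S : 'M[R]_k).
Local Notation t := n.+2.
Hypothesis k0 : (0 < k)%N.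
Hypothesis SB : Btilde S = mean_proj R k.
Implicit Types (s : seqT k t) (xi : measure_on R k t).

Local Notation N := (#|'S_t|%:R : R).

Lemma card_perms_gt0 : 0 < N.
Proof. by rewrite ltr0n; apply/card_gt0P; exists 1%g. Qed.

Lemma perm_inv_inj : injective (fun sg : 'S_t => (sg^-1)%g).
Proof. exact: invg_inj. Qed.

Lemma perm_mul_inj (ta : 'S_t) : injective (fun sg : 'S_t => (ta * sg)%g).
Proof. exact: mulgI. Qed.

Definition relabel (sg : 'S_t) s : seqT k t := [ffun j => sg (s j)].

Lemma relabelK (sg : 'S_t) : cancel (relabel sg) (relabel sg^-1%g).
Proof. by move=> s; apply/ffunP => j; rewrite !ffunE permK. Qed.

Lemma relabel_inj (sg : 'S_t) : injective (relabel sg).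
Proof. exact: can_inj (relabelK sg). Qed.

Definition symmetrize xi : measure_on R k t :=
  [ffun s => N^-1 * \sum_(sg : 'S_t) xi (relabel sg s)].

Lemma symmetrize_measure xi : is_measure xi -> is_measure (symmetrize xi).
Proof.
move=> [x0 x1]; split=> [s|].
  by rewrite ffunE mulr_ge0 ?invr_ge0 ?sumr_ge0.
under eq_bigr do rewrite ffunE.
rewrite -mulr_sumr exchange_big /= (eq_bigr (fun=> 1)); last first.
  by move=> sg _; rewrite -x1 [RHS](reindex_inj (@relabel_inj sg)).
by rewrite sumr_const mulVf // gt_eqF // card_perms_gt0.
Qed.

Lemma Tmat_relabel (sg : 'S_t) s : Tmat R (relabel sg s) = Tmat R s *m perm_mx sg.
Proof.
apply/matrixP => j i; rewrite !mxE (bigD1 (s j)) //= !mxE eqxx mul1r.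
rewrite big1 ?addr0 ?ffunE // => l hl.
by rewrite !mxE eq_sym (negPf hl) mul0r.
Qed.

Lemma Cs_relabel (sg : 'S_t) s i j :
  Cs S (relabel sg s) i j = (perm_mx sg)^T *m Cs S s i j *m perm_mx sg.
Proof.
have GE (l : 'I_3) : Gmat R l (relabel sg s) = Gmat R l s *m perm_mx sg.
  rewrite /Gmat /Lmat /Rmat Tmat_relabel !mulmxA.
  by case: (val l) => [|[|m]].
by rewrite /Cs !GE trmx_mul !mulmxA.
Qed.

Definition avg (C : 'M[R]_t) : 'M[R]_t :=
  N^-1 *: \sum_(sg : 'S_t) (perm_mx sg)^T *m C *m perm_mx sg.

Lemma Cxi_symmetrize xi i j : Cxi S (symmetrize xi) i j = avg (Cxi S xi i j).
Proof.
rewrite /Cxi /avg.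
transitivity (N^-1 *: \sum_s \sum_(sg : 'S_t) xi (relabel sg s) *: Cs S s i j).
  rewrite scaler_sumr; apply: eq_bigr => s _; rewrite ffunE -scalerA.
  by rewrite scaler_suml.
(* Moving a relabelling from the measure to the sequences inverts it; the sum over all permutations
   absorbs the inverse. *)
congr (_ *: _); rewrite exchange_big /= (reindex_inj perm_inv_inj) /=.
apply: eq_bigr => sg _; rewrite (reindex_inj (@relabel_inj sg)) /=.
rewrite mulmx_sumr mulmx_suml; apply: eq_bigr => s _.
by rewrite relabelK Cs_relabel -scalemxAr -scalemxAl.
Qed.

Lemma avg_sum (I : finType) (F : I -> 'M[R]_t) (a : I -> R) :
  avg (\sum_i a i *: F i) = \sum_i a i *: avg (F i).
Proof.
rewrite /avg; transitivity (\sum_i \sum_(sg : 'S_t)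
    (N^-1 * a i) *: ((perm_mx sg)^T *m F i *m perm_mx sg)).
  rewrite exchange_big scaler_sumr; apply: eq_bigr => sg _.
  rewrite mulmx_sumr mulmx_suml scaler_sumr; apply: eq_bigr => i _.
  by rewrite -scalemxAr -scalemxAl scalerA.
by apply: eq_bigr => i _; rewrite -scaler_sumr scalerA mulrC.
Qed.

Lemma Cuw_symmetrize xi u v : Cuw S (symmetrize xi) u v = avg (Cuw S xi u v).
Proof.
rewrite /Cuw pair_bigA [in RHS]pair_bigA /= avg_sum.
by apply: eq_bigr => ij _; rewrite Cxi_symmetrize.
Qed.

Lemma avgE (C : 'M[R]_t) i j : avg C i j = N^-1 * \sum_(sg : 'S_t) C (sg i) (sg j).
Proof.
rewrite mxE summxE [in RHS](reindex_inj perm_inv_inj); congr (_ * _).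
by apply: eq_bigr => sg _; rewrite tr_perm_mx -row_permE
  -[X in _ *m perm_mx X]invgK -col_permE !mxE.
Qed.

Lemma avg_perm (C : 'M[R]_t) (ta : 'S_t) i j : avg C (ta i) (ta j) = avg C i j.
Proof.
rewrite !avgE [in RHS](reindex_inj (@perm_mul_inj ta)); congr (_ * _).
by apply: eq_bigr => sg _; rewrite !permM.
Qed.

(** Entries of the average are invariant under simultaneous permutation of both indices.
    Transpositions carry each diagonal entry to position (0, 0) and each other entry to (0, 1). *)
Lemma avg_completely_symmetric (C : 'M[R]_t) : completely_symmetric (avg C).
Proof.
pose o1 : 'I_t := lift ord0 ord0; set M := avg C.
have MP (ta : 'S_t) i j : M (ta i) (ta j) = M i j := avg_perm C ta i j.
have diag i : M i i = M 0 0 by rewrite -(MP (tperm 0 i)) !tpermR.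
have row0 j : j != 0 -> M 0 j = M 0 o1.
  by move=> j0; rewrite -(MP (tperm j o1)) tpermL tpermD // eq_sym.
have off i j : i != j -> M i j = M 0 o1.
  move=> ij; rewrite -(MP (tperm i 0)) tpermL; apply: row0.
  apply: contra ij => /eqP h; apply/eqP; apply: (@perm_inj _ (tperm i 0)).
  by rewrite h tpermL.
exists (M 0 0 - M 0 o1), (M 0 o1); apply/matrixP => i j.
have -> a b : (a *: 1%:M + b *: const_mx 1 : 'M[R]_t) i j = a * (i == j)%:R + b.
  by rewrite !mxE mulr1.
have [->|/off ->] := eqVneq i j.
  by rewrite diag mulr1 subrK.
by rewrite mulr0 add0r.
Qed.

Lemma symmetrize_pseudo xi : pseudo_symmetric S (symmetrize xi).
Proof. by move=> i j; rewrite Cxi_symmetrize; apply: avg_completely_symmetric. Qed.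

Lemma avg_trace (C : 'M[R]_t) : \tr (avg C) = \tr C.
Proof.
rewrite /avg mxtraceZ raddf_sum (eq_bigr (fun=> \tr C)) => [|sg _].
  by rewrite sumr_const -[\tr C *+ _]mulr_natl mulKf // gt_eqF // card_perms_gt0.
by rewrite /= mxtrace_mulC mulmxA tr_perm_mx -perm_mxM mulgV perm_mx1 mul1mx.
Qed.

Lemma qval_symmetrize xi u : qval S (symmetrize xi) u = qval S xi u.
Proof. by rewrite /qval Cuw_symmetrize avg_trace. Qed.

Lemma qform_avg (C : 'M[R]_t) x :
  N * qform (avg C) x = \sum_(sg : 'S_t) qform C (perm_mx sg *m x).
Proof.
rewrite /qform /avg -scalemxAr -scalemxAl mxE mulVKf ?gt_eqF ?card_perms_gt0 //.
rewrite mulmx_sumr mulmx_suml summxE; apply: eq_bigr => sg _.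
by rewrite trmx_mul !mulmxA.
Qed.

Lemma qform1_perm (sg : 'S_t) (x : 'cV[R]_t) :
  qform 1%:M (perm_mx sg *m x) = qform 1%:M x.
Proof.
by rewrite -qform_gram tr_perm_mx -perm_mxM mulVg perm_mx1.
Qed.

Lemma contrast_perm (sg : 'S_t) (x : 'cV[R]_t) : contrast x -> contrast (perm_mx sg *m x).
Proof.
move=> [x1 x0]; split.
  rewrite mulmxA (_ : _ *m perm_mx sg = const_mx 1) //.
  by rewrite -[sg]invgK -col_permE; apply/matrixP => i j; rewrite !mxE.
apply: contra x0 => /eqP h.
by rewrite -[x]mul1mx -perm_mx1 -(mulVg sg) perm_mxM -mulmxA h mulmx0.
Qed.

(** * Criterion values and optimality within a single model *)

Section Model.
Variables (m : nat) (u : 'cV[R]_3) (w : 'I_m -> 'cV[R]_3) (nu : R).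
Hypothesis nu0 : 0 < nu.
Variable g : probability (t.-tuple R) R.
Hypotheses (gT : distribution_on_T g) (gex : exchangeable g).

Definition Cmodel xi (x : 'cV[R]_t) : 'M[R]_t := nu *: Iinfo S xi u w x.

(* A fixed contrast: for pseudo symmetric measures the eigenvalue of the
   information matrix in the direction [x] does not depend on [x]. *)
Definition contrast0 : 'cV[R]_t := \col_i ((i == 0)%:R - (i == 1)%:R).

Lemma contrast0P : contrast contrast0.
Proof.
split; last first.
  by apply/eqP => /colP /(_ 0); rewrite !mxE /= subr0; apply/eqP; rewrite oner_eq0.
apply/colP => i; rewrite !mxE (eq_bigr (fun j : 'I_t => (j == 0)%:R - (j == 1)%:R)).
  have one_at (l : 'I_t) : \sum_(j : 'I_t) (j == l)%:R = 1 :> R.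
    by rewrite (bigD1 l) //= eqxx big1 ?addr0 // => j /negPf ->.
  by rewrite sumrB !one_at subrr.
by move=> j _; rewrite !mxE mul1r.
Qed.

Definition qmin xi : R := along (Iinfo S xi u w contrast0) contrast0.

Definition model_value c xi : R := phi2 n c (nu * qmin xi) (nu * qval S xi u).

Lemma qmin_ge0 xi : (forall s, 0 <= xi s) -> 0 <= qmin xi.
Proof.
move=> /(gram_Cxi k0 SB) gr; apply: along_ge0.
by have [] := Iinfo_spec gr u w contrast0.
Qed.

(** On contrasts, each [C_xi[v, v]] acts as the scalar [qval v], so dividing the minimum of
    [Iinfo_spec] by [x'x] leaves a minimum of [qval] that no longer involves [x]. *)
Lemma along_pseudo xi : (forall s, 0 <= xi s) -> pseudo_symmetric S xi ->
  forall x, contrast x ->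
  (exists be, along (Iinfo S xi u w x) x = qval S xi (affine_shift u w be)) /\
  (forall be, along (Iinfo S xi u w x) x <= qval S xi (affine_shift u w be)).
Proof.
move=> /(gram_Cxi k0 SB) gr ps x hx; have [_ _ [be h1] h2] := Iinfo_spec gr u w x.
have X0 : 0 < qform 1%:M x by apply: qform1_gt0; case: hx.
have qE be' : qform (Cuw S xi (affine_shift u w be') (affine_shift u w be')) x =
  qval S xi (affine_shift u w be') * qform 1%:M x by apply: qform_pseudo.
split; first by exists be; rewrite /along h1 qE mulfK // gt_eqF.
by move=> be'; rewrite /along ler_pdivrMr // -qE.
Qed.

Lemma along_qmin xi x : (forall s, 0 <= xi s) -> pseudo_symmetric S xi ->
  contrast x -> along (Iinfo S xi u w x) x = qmin xi.
Proof.
move=> x0 ps hx; have [[b1 h1] h2] := along_pseudo x0 ps hx.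
have [[b3 h3] h4] := along_pseudo x0 ps contrast0P.
by apply: le_anti; rewrite /qmin {1}h3 h2 h1 h4.
Qed.

Lemma qmin_le_qval xi : (forall s, 0 <= xi s) -> pseudo_symmetric S xi ->
  qmin xi <= qval S xi u.
Proof.
move=> x0 ps; have [_ h] := along_pseudo x0 ps contrast0P.
have := h (fun=> 0); rewrite /affine_shift big1 ?addr0 // => a _.
exact: scale0r.
Qed.

Lemma Phi_pseudo c xi x : (forall s, 0 <= xi s) -> pseudo_symmetric S xi ->
  contrast x -> Phi c (Cmodel xi x) = model_value c xi.
Proof.
move=> x0 ps hx; rewrite /Cmodel (Iinfo_two_level (gram_Cxi k0 SB x0) u w ps hx).
rewrite along_qmin // (_ : nu *: _ = two_level (nu * qmin xi) (nu * qval S xi u) x).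
  apply: Phi_two_level => //; first by rewrite mulr_ge0 ?qmin_ge0 ?ltW.
  by rewrite ler_pM2l // qmin_le_qval.
move: (qval S xi u) (qmin xi) => b a.
by rewrite /two_level scalerBr !scalerA -mulrBr mulrA.
Qed.

Lemma colv_contrast (x : t.-tuple R) : @Tset R t x -> contrast (colv x).
Proof.
move=> /andP[/eqP h /existsP[i hi]]; split.
  apply/colP => j; rewrite mxE [RHS]mxE; apply: etrans h; apply: eq_bigr => l _.
  by rewrite !mxE mul1r.
by apply: contra hi => /eqP /colP /(_ i); rewrite !mxE => ->.
Qed.

Lemma colv_permute (sg : 'S_t) (x : t.-tuple R) :
  colv (permute_tuple sg x) = perm_mx sg *m colv x.
Proof. by rewrite -row_permE; apply/colP => i; rewrite !mxE tnth_mktuple. Qed.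

Lemma crit_value_pseudo c xi : (forall s, 0 <= xi s) -> pseudo_symmetric S xi ->
  crit_value g c Cmodel xi = (model_value c xi)%:E.
Proof.
move=> x0 ps; rewrite /crit_value.
transitivity (\int[g]_(x in @Tset R t) (cst (model_value c xi)%:E) x)%E.
  apply: eq_integral => x; rewrite inE => Tx /=.
  by rewrite Phi_pseudo //; apply: colv_contrast.
rewrite integral_cst; last exact: measurable_Tset.
by rewrite [X in (_ * X)%E](_ : _ = 1%E) ?mule1 //; exact: gT.
Qed.

Lemma Cmodel_info xi x : (forall s, 0 <= xi s) -> info_matrix (Cmodel xi x).
Proof.
move=> /(gram_Cxi k0 SB) gr; have [[[Is Ip] I1] _ _ _] := Iinfo_spec gr u w x.
split; last by rewrite /Cmodel -scalemxAl I1 scaler0.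
split; first by rewrite /Cmodel linearZ /= Is.
move=> v; rewrite /qform /Cmodel -scalemxAr -scalemxAl mxE.
by apply: mulr_ge0 (ltW nu0) (Ip v).
Qed.

(** Permuting [x] and averaging replaces [C_xi[v, v]] by its symmetrisation. This gives the two
    averaged bounds that [sum_Phi_le] asks for, and exchangeability carries the resulting bound to
    the integral. *)
Lemma crit_value_le c xi : is_measure xi ->
  (crit_value g c Cmodel xi <= (model_value c (symmetrize xi))%:E)%E.
Proof.
move=> mxi; have [x0 _] := mxi; have [y0 _] := symmetrize_measure mxi.
have ps := symmetrize_pseudo xi; set xih := symmetrize xi in y0 ps *.
have a0 : 0 <= nu * qmin xih by rewrite mulr_ge0 ?qmin_ge0 ?ltW.
have ab : nu * qmin xih <= nu * qval S xih u by rewrite ler_pM2l // qmin_le_qval.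
have gr := gram_Cxi k0 SB x0.
apply: integral_le_of_average => //.
- by rewrite -(Phi_pseudo c y0 ps contrast0P); apply: Phi_ge0 contrast0P; apply: Cmodel_info.
- by move=> x /colv_contrast hx; apply: Phi_ge0 hx; apply: Cmodel_info.
move=> x /colv_contrast; set y := colv x => hy.
under eq_bigr do rewrite colv_permute.
have Y0 : 0 < qform 1%:M y by apply: qform1_gt0; case: hy.
have alongE C sg : along C (perm_mx sg *m y) = qform C (perm_mx sg *m y) / qform 1%:M y.
  by rewrite /along qform1_perm.
have avgval v : \sum_(sg : 'S_t) along (Cuw S xi v v) (perm_mx sg *m y) = N * qval S xih v.
  under eq_bigr do rewrite alongE.
  rewrite -mulr_suml -qform_avg -Cuw_symmetrize (qform_pseudo (gram_Cxi k0 SB y0) ps) //.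
  by rewrite mulrA mulfK // gt_eqF.
have alongZ C z : along (nu *: C) z = nu * along C z.
  by rewrite /along /qform -scalemxAr -scalemxAl mxE mulrA.
apply: (@sum_Phi_le _ _ c _ _ _ (fun sg : 'S_t => Cmodel xi (perm_mx sg *m y))
  (fun sg : 'S_t => perm_mx sg *m y)) => //.
- by move=> sg; apply: Cmodel_info.
- by move=> sg; apply: contrast_perm.
(* The coefficients minimising for the symmetrised measure serve as one trial point for every
   permutation of [y]. *)
- have [[be hbe] _] := along_pseudo y0 ps contrast0P.
  rewrite /qmin hbe mulrCA -avgval mulr_sumr; apply: ler_sum => sg _.
  rewrite /Cmodel alongZ ler_pM2l // !alongE ler_pM2r ?invr_gt0 //.
  by have [_ _ _] := Iinfo_spec gr u w (perm_mx sg *m y); apply.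
(* [C_xi[u, u] - I] is positive semidefinite, so its Rayleigh quotient is at most its trace; hence
   passing from [C_xi[u, u]] to [I] cannot increase the trace minus the Rayleigh quotient. *)
- rewrite (mulrCA n%:R nu) (mulrCA _ nu).
  have -> : N * (n%:R * qval S xih u) =
     \sum_(sg : 'S_t) (\tr (Cuw S xi u u) - along (Cuw S xi u u) (perm_mx sg *m y)).
    rewrite sumrB avgval sumr_const -[\tr _ *+ _]mulr_natl -mulrBr; congr (_ * _).
    have -> : \tr (Cuw S xi u u) = n.+1%:R * qval S xih u.
      by rewrite /xih qval_symmetrize /qval mulrC divfK // pnatr_eq0.
    by rewrite -natr1 mulrDl mul1r addrK.
  rewrite mulr_sumr; apply: ler_sum => sg _.
  rewrite /Cmodel alongZ mxtraceZ -mulrBr ler_pM2l //.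
  have [_ hp _ _] := Iinfo_spec gr u w (perm_mx sg *m y).
  move: (Iinfo S xi u w (perm_mx sg *m y)) hp => I hp.
  have := psd_le_trace (perm_mx sg *m y) hp.
  rewrite qform1_perm -ler_pdivrMr // -alongE raddfB /=.
  have -> : along (Cuw S xi u u - I) (perm_mx sg *m y) =
     along (Cuw S xi u u) (perm_mx sg *m y) - along I (perm_mx sg *m y).
    rewrite /along -scaleN1r qformD mulrDl; congr (_ + _).
    by rewrite /qform -scalemxAr -scalemxAl mxE mulN1r mulNr.
  lra.
Qed.

(** Any competitor is dominated by its symmetrisation, which is pseudo symmetric, and on pseudo
    symmetric measures the criterion is the number [model_value]. *)
Lemma optimalP c xi : is_measure xi -> pseudo_symmetric S xi ->
  optimal g c Cmodel xi <->
  (forall xi', is_measure xi' -> pseudo_symmetric S xi' ->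
   model_value c xi' <= model_value c xi).
Proof.
move=> mxi ps; have [x0 _] := mxi; split.
  move=> [_ h] xi' mxi' ps'; have [x0' _] := mxi'.
  by have := h xi' mxi'; rewrite !crit_value_pseudo // lee_fin.
move=> h; split=> [|xi' mxi']; first exact: mxi.
have h1 := crit_value_le c mxi'.
have h2 : model_value c (symmetrize xi') <= model_value c xi.
  by apply: h; [exact: symmetrize_measure|exact: symmetrize_pseudo].
have h3 : crit_value g c Cmodel xi = (model_value c xi)%:E by apply: crit_value_pseudo.
rewrite h3; apply: (le_trans h1).
by rewrite lee_fin.
Qed.

End Model.
End Symmetrization.

(** * Comparison of the undirectional and directional models *)

Section Comparison.
Variables (R : realType) (k n : nat) (S : 'M[R]_k).
Local Notation t := n.+2.
Hypothesis k0 : (0 < k)%N.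
Hypothesis SB : Btilde S = mean_proj R k.

Lemma vec3D (a b c a' b' c' : R) :
  vec3 a b c + vec3 a' b' c' = vec3 (a + a') (b + b') (c + c').
Proof. by apply/colP => -[[|[|[|i]]] hi]; rewrite !mxE. Qed.

Lemma vec3Z (r a b c : R) : r *: vec3 a b c = vec3 (r * a) (r * b) (r * c).
Proof. by apply/colP => -[[|[|[|i]]] hi]; rewrite !mxE. Qed.

Lemma affine_shift_one (u w : 'cV[R]_3) be : affine_shift u (one_vec w) be = u + be 0 *: w.
Proof. by rewrite /affine_shift big_ord1. Qed.

Lemma affine_shift_two (u w1 w2 : 'cV[R]_3) be :
  affine_shift u (two_vecs w1 w2) be = u + (be 0 *: w1 + be 1 *: w2).
Proof.
rewrite /affine_shift big_ord_recl big_ord1; congr (_ + (_ + be _ *: _)).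
exact: val_inj.
Qed.

Section Value.
Variable xi : measure_on R k t.
Hypothesis xi0 : forall s, 0 <= xi s.
Local Notation Q a b c := (qval S xi (vec3 a b c)).

Lemma qval_ge0 v : 0 <= qval S xi v.
Proof.
have h := Cuw_psd (gram_Cxi k0 SB xi0) v.
have hx := contrast0P R n.
by rewrite divr_ge0 // (le_trans (along_ge0 _ h) (along_le_trace h hx)).
Qed.

Lemma qval_homog r a b c : Q (r * a) (r * b) (r * c) = r ^+ 2 * Q a b c.
Proof. by rewrite !(qval_vec3 SB); ring. Qed.

(* The cyclic structure makes [Q] invariant under exchanging the left and right
   neighbour coordinates, so averaging the two only decreases it. *)
Lemma qval_mid a b c : Q a ((b + c) / 2) ((b + c) / 2) <= Q a b c.
Proof.
rewrite -subr_ge0.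
(* The cross term between the symmetric point and the antisymmetric direction [(0, 1, -1)]
   vanishes. *)
have -> : Q a b c - Q a ((b + c) / 2) ((b + c) / 2) =
  ((b - c) / 2) ^+ 2 * Q 0 1 (-1).
  by rewrite !(qval_vec3 SB); move: ((n.+1%:R : R)^-1) => z; field.
by rewrite mulr_ge0 ?sqr_ge0 ?qval_ge0.
Qed.

Hypothesis ps : pseudo_symmetric S xi.

(** The minimum on the right is attained, so it suffices to match its minimiser by some point on the
    left. *)
Lemma qmin_le m (u : 'cV[R]_3) (w : 'I_m -> 'cV[R]_3) (nu : R)
    m' (u' : 'cV[R]_3) (w' : 'I_m' -> 'cV[R]_3) (nu' : R) : 0 < nu ->
  (forall be', exists be,
     nu * qval S xi (affine_shift u w be) <= nu' * qval S xi (affine_shift u' w' be')) ->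
  nu * qmin S u w xi <= nu' * qmin S u' w' xi.
Proof.
move=> nu0 h.
have [_ h1] := along_pseudo k0 SB u w xi0 ps (contrast0P R n).
have [[be' h2] _] := along_pseudo k0 SB u' w' xi0 ps (contrast0P R n).
have [be hbe] := h be'; rewrite {2}/qmin h2; apply: le_trans hbe.
by rewrite ler_pM2l //; apply: h1.
Qed.

(** The affine spaces are the points [(1, y, y)] and all points [(1, b, c)]. One contains the other,
    and [qval_mid] moves [(1, b, c)] to its midpoint at no cost. *)
Lemma qmin_tau (l l1 l2 : R) :
  qmin S (vec3 1 l l) (one_vec (vec3 0 1 1)) xi =
  qmin S (vec3 1 l1 l2) (two_vecs (vec3 0 1 0) (vec3 0 0 1)) xi.
Proof.
rewrite -[LHS]mul1r -[RHS]mul1r; apply: le_anti; apply/andP; split;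
  apply: qmin_le => // be.
- pose b := l1 + be 0; pose c := l2 + be 1.
  exists (fun=> (b + c) / 2 - l); rewrite !mul1r.
  rewrite affine_shift_one affine_shift_two !vec3Z !vec3D.
  rewrite !(mulr0, mulr1, addr0, add0r) [l + _]addrC subrK.
  exact: qval_mid.
- exists (fun i => l + be 0 - (if i == 0 then l1 else l2)).
  rewrite !mul1r affine_shift_one affine_shift_two !vec3Z !vec3D /=.
  rewrite !(mulr0, mulr1, addr0, add0r).
  by rewrite [l1 + _]addrC [l2 + _]addrC !subrK.
Qed.

(** The undirectional space is the set of [(a, b, b)] with coordinate sum [1 + 2 * l], the
    directional one the plane of coordinate sum [1 + l1 + l2]. Rescaling matches the two sums, and
    the normalising factors compensate exactly since [qval] is homogeneous of degree two. *)
Lemma qmin_theta (l l1 l2 : R) : 1 + 2 * l != 0 -> 1 + l1 + l2 != 0 ->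
  (1 + 2 * l) ^- 2 * qmin S (vec3 1 l l) (one_vec (vec3 2 (-1) (-1))) xi =
  (1 + l1 + l2) ^- 2 * qmin S (vec3 1 l1 l2)
    (two_vecs (vec3 (-1) (1 + l2) (- l2)) (vec3 (-1) (- l1) (1 + l1))) xi.
Proof.
move=> d0 d1; set D0 := 1 + 2 * l in d0 *; set D1 := 1 + l1 + l2 in d1 *.
have pos (x : R) : x != 0 -> 0 < x ^- 2.
  by move=> x0; rewrite invr_gt0 lt_def sqr_ge0 sqrf_eq0 x0.
have scale (x y : R) : x != 0 -> y != 0 -> exists2 r, r * y = x & x ^- 2 * r ^+ 2 = y ^- 2.
  by move=> x0 y0; exists (x / y); [rewrite divfK|field; rewrite x0 y0].
apply: le_anti; apply/andP; split; apply: qmin_le => //; try exact: pos.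
- move=> be; rewrite affine_shift_two !vec3Z !vec3D.
  set a := 1 + (be 0 * -1 + _); set b := l1 + _; set c := l2 + (be 0 * _ + _).
  have abc : a + b + c = D1 by rewrite /a /b /c /D1; ring.
  have [r rD r2] := scale _ _ d0 d1.
  (* The coefficient is read off the first coordinate, [1 + 2 * be = r * a]; the coordinate sum
     fixes the other two. *)
  exists (fun=> (r * a - 1) / 2); rewrite affine_shift_one vec3Z vec3D.
  have -> : vec3 (1 + (r * a - 1) / 2 * 2) (l + (r * a - 1) / 2 * -1)
          (l + (r * a - 1) / 2 * -1) =
     vec3 (r * a) (r * ((b + c) / 2)) (r * ((b + c) / 2)).
    have bc : r * ((b + c) / 2) = (1 + 2 * l - r * a) / 2.
      have -> : 1 + 2 * l = r * (a + b + c) by rewrite abc rD.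
      by move: a b c {abc} => a b c; field.
    by rewrite bc; congr vec3; field.
  rewrite qval_homog mulrA r2.
  by rewrite ler_pM2l ?pos //; apply: qval_mid.
- move=> be; rewrite affine_shift_one !vec3Z !vec3D.
  set a := 1 + be 0 * _; set b := l + be 0 * _.
  have ab : a + 2 * b = D0 by rewrite /a /b /D0; ring.
  have [r rD r2] := scale _ _ d1 d0; pose b' := r * b.
  (* Cramer's rule for making the last two coordinates equal to [b']; the system has determinant
     [D1]. *)
  exists (fun i => if i == 0 then ((1 + l1) * (b' - l1) + l1 * (b' - l2)) / D1
                   else ((1 + l2) * (b' - l2) + l2 * (b' - l1)) / D1).
  rewrite affine_shift_two !vec3Z !vec3D /=.
  have -> : vec3 (1 + (((1 + l1) * (b' - l1) + l1 * (b' - l2)) / D1 * -1 +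
                     ((1 + l2) * (b' - l2) + l2 * (b' - l1)) / D1 * -1))
    (l1 + (((1 + l1) * (b' - l1) + l1 * (b' - l2)) / D1 * (1 + l2) +
                     ((1 + l2) * (b' - l2) + l2 * (b' - l1)) / D1 * - l1))
    (l2 + (((1 + l1) * (b' - l1) + l1 * (b' - l2)) / D1 * - l2 +
                     ((1 + l2) * (b' - l2) + l2 * (b' - l1)) / D1 * (1 + l1))) =
    vec3 (r * a) (r * b) (r * b).
    have aE : r * a = 1 + l1 + l2 - 2 * b' by rewrite -/D1 -rD -ab /b'; ring.
    by rewrite aE -/b' /D1; congr vec3; field; exact: d1.
  by rewrite qval_homog mulrA r2.
Qed.

End Value.

(** The value of a criterion depends only on the scaled [qmin] and the scaled [qval u], and the
    E-criterion ignores the second. *)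
Lemma optimal_iff (g : probability (t.-tuple R) R) c
    m (u : 'cV[R]_3) (w : 'I_m -> 'cV[R]_3) (nu : R)
    m' (u' : 'cV[R]_3) (w' : 'I_m' -> 'cV[R]_3) (nu' : R) :
  distribution_on_T g -> exchangeable g -> 0 < nu -> 0 < nu' ->
  (c = critE \/ (u = u' /\ nu = nu')) ->
  (forall xi : measure_on R k t, (forall s, 0 <= xi s) -> pseudo_symmetric S xi ->
     nu * qmin S u w xi = nu' * qmin S u' w' xi) ->
  forall xi : measure_on R k t, is_measure xi -> pseudo_symmetric S xi ->
  optimal g c (fun xi' => Cmodel S u w nu xi') xi <->
  optimal g c (fun xi' => Cmodel S u' w' nu' xi') xi.
Proof.
move=> gT gex nu0 nu0' hc hq xi mxi ps.
have KE (xi' : measure_on R k t) : is_measure xi' -> pseudo_symmetric S xi' ->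
    model_value S u w nu c xi' = model_value S u' w' nu' c xi'.
  move=> [x0 _] ps'; rewrite /model_value hq //.
  by case: hc => [->|[-> ->]].
rewrite !(optimalP k0 SB) //; split=> h xi' mxi' ps'.
  by rewrite -!KE //; apply: h.
by rewrite !KE //; apply: h.
Qed.

End Comparison.

Theorem theorem5 (R : realType) (k t : nat) (hk : (2 <= k)%N) (ht : (2 <= t)%N)
  (S : 'M[R]_k) (hS : posdef S) (hH : typeH S)
  (g : probability (t.-tuple R) R) (hgT : distribution_on_T g) (hgex : exchangeable g)
  (l l1 l2 : R) (c : criterion) (hc : c = critE \/ (l1 = l /\ l2 = l)) :
  (forall xi : measure_on R k t, is_measure xi -> pseudo_symmetric S xi ->
     (optimal g c (fun xi' => C_tau_undir S xi' l) xi <->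
      optimal g c (fun xi' => C_tau_dir S xi' l1 l2) xi)) /\
  (1 + 2 * l != 0 -> 1 + l1 + l2 != 0 ->
   forall xi : measure_on R k t, is_measure xi -> pseudo_symmetric S xi ->
     (optimal g c (fun xi' => C_theta_undir S xi' l) xi <->
      optimal g c (fun xi' => C_theta_dir S xi' l1 l2) xi)).
Proof.
have k0 : (0 < k)%N by apply: leq_trans hk.
have SB := Btilde_typeH k0 hS hH.
case: t ht g hgT hgex => [//|[//|n]] _ g gT gex; split.
  have h := optimal_iff k0 SB (c := c) (u := vec3 1 l l) (w := one_vec (vec3 0 1 1)) (nu := 1)
    (u' := vec3 1 l1 l2) (w' := two_vecs (vec3 0 1 0) (vec3 0 0 1)) (nu' := 1)
    gT gex ltr01 ltr01.
  (* The direct effect carries no normalisation, so its scaling factor is 1. *)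
  have EM m (u : 'cV[R]_3) (w : 'I_m -> 'cV[R]_3) :
      (fun xi' : measure_on R k n.+2 => Iinfo S xi' u w) = (fun xi' => Cmodel S u w 1 xi').
    by apply/funext => xi'; apply/funext => x; rewrite /Cmodel scale1r.
  rewrite /C_tau_undir /C_tau_dir.
  rewrite (EM 1%N) (EM 2%N); apply: h.
    by case: hc => [->|[-> ->]]; [left|right].
  by move=> xi x0 ps; rewrite !mul1r; apply: (qmin_tau k0 SB x0 ps).
move=> d0 d1.
have pos (x : R) : x != 0 -> 0 < x ^- 2.
  by move=> x0; rewrite invr_gt0 lt_def sqr_ge0 sqrf_eq0 x0.
have h := optimal_iff k0 SB (c := c) (u := vec3 1 l l) (w := one_vec (vec3 2 (-1) (-1)))
  (u' := vec3 1 l1 l2)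
  (w' := two_vecs (vec3 (-1) (1 + l2) (- l2)) (vec3 (-1) (- l1) (1 + l1)))
  gT gex (pos _ d0) (pos _ d1).
apply: h.
  case: hc => [->|[-> ->]]; first by left.
  (* When [l1 = l2 = l], the two normalising factors coincide. *)
  by right; split=> [//|]; congr (_ ^- 2); ring.
by move=> xi x0 ps; apply: (qmin_theta k0 SB x0 ps).
Qed.
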